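(* Let $R$ be a commutative noetherian ring. If $C$ is a semidualizing $R$-module and $M$ is an $R$-module such that $\mathcal{P}_C\text{-}\operatorname{pd}_R(M)<\infty$ and $\mathcal{I}_C\text{-}\operatorname{id}_R(M)=0$, then $R_{\mathfrak{p}}$ is Gorenstein for all $\mathfrak{p}\in\operatorname{Spec}(R)$ such that $\operatorname{depth}_{R_{\mathfrak{p}}}(M_{\mathfrak{p}})$ is finite.
   Context: Modules are not assumed finitely generated unless stated. A finitely generated $R$-module $C$ is semidualizing if the natural homothety map $R\to\operatorname{Hom}_R(C,C)$ is an isomorphism and $\operatorname{Ext}^{i}_R(C,C)=0$ for all $i\geq 1$. For a class $\mathcal{X}$ of $R$-modules, an $\mathcal{X}$-resolution of $M$ is a complex $X=\cdots\to X_1\to X_0\to 0$ of modules in $\mathcal{X}$ with $\operatorname{H}_0(X)\cong M$ and $\operatorname{H}_n(X)=0$ for $n\geq 1$; the $\mathcal{X}$-projective dimension $\mathcal{X}\text{-}\operatorname{pd}_R(M)$ is the infimum over all $\mathcal{X}$-resolutions $X$ of $M$ of $\sup\{n\geq 0\mid X_n\neq 0\}$. Dually, an $\mathcal{X}$-coresolution of $M$ is a complex $X=0\to X_0\to X_{-1}\to X_{-2}\to\cdots$ of modules in $\mathcal{X}$ with $\operatorname{H}_0(X)\cong M$ and $\operatorname{H}_n(X)=0$ for $n\leq -1$; the $\mathcal{X}$-injective dimension $\mathcal{X}\text{-}\operatorname{id}_R(M)$ is the infimum over all $\mathcal{X}$-coresolutions $X$ of $M$ of $\sup\{-n\geq 0\mid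 X_n\neq 0\}$. Conventions: each of these dimensions is $\infty$ if no such (co)resolution exists, and is $-\infty$ for $M=0$; the modules of $\mathcal{X}$-projective (respectively $\mathcal{X}$-injective) dimension $0$ are the nonzero modules of $\mathcal{X}$. $\mathcal{P}_C(R)$ is the class of modules isomorphic to $P\otimes_R C$ with $P$ a projective $R$-module, and $\mathcal{I}_C(R)$ is the class of modules isomorphic to $\operatorname{Hom}_R(C,I)$ with $I$ an injective $R$-module; $\mathcal{P}_C\text{-}\operatorname{pd}_R$ and $\mathcal{I}_C\text{-}\operatorname{id}_R$ are the associated dimensions. For a local ring $S$ with residue field $k$ and any $S$-module $N$, $\operatorname{depth}_S(N)=\inf\{n\geq 0\mid\operatorname{Ext}^n_S(k,N)\neq 0\}$ (with $\inf\emptyset=\infty$). *)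

(* Defs.v *)
From HB Require Import structures.
From mathcomp Require Import all_boot all_order all_algebra.
From mathcomp Require Import all_classical all_reals.
From mathcomp Require Import ereal Rstruct.

Set Implicit Arguments.
Unset Strict Implicit.
Unset Printing Implicit Defensive.

Import Order.TTheory GRing.Theory Num.Theory.

Local Open Scope classical_set_scope.
Local Open Scope ring_scope.

Section Ideals.
Variable R : comPzRingType.

Definition is_ideal (I : set R) : Prop :=
  [/\ I 0, forall x y, I x -> I y -> I (x + y) & forall a x, I x -> I (a * x)].

Definition prime_ideal (p : set R) : Prop :=
  [/\ is_ideal p, ~ p 1 & forall x y, p (x * y) -> p x \/ p y].

Definition maximal_ideal (m : set R) : Prop :=
  [/\ is_ideal m, ~ m 1 &
      forall I : set R, is_ideal I -> ~ I 1 -> m `<=` I -> I = m].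

Definition local_ring : Prop := exists! m : set R, maximal_ideal m.

Definition noetherian : Prop := forall I : set R, is_ideal I ->
  exists (n : nat) (g : 'I_n -> R),
    I = range (fun a : 'I_n -> R => \sum_(i < n) a i * g i).

End Ideals.

Section Localization.
Variables (R S : comPzRingType) (p : set R) (f : {rmorphism R -> S}).

(* [f] exhibits [S] as the ring of fractions r/s with s outside [p]. *)
Definition is_localization : Prop :=
  [/\ forall s, ~ p s -> exists u, u * f s = 1,
      forall z, exists r s u, [/\ ~ p s, u * f s = 1 & z = u * f r] &
      forall x y, f x = f y -> exists2 s, ~ p s & s * x = s * y].

(* [g] exhibits [N] as the module of fractions m/s with s outside [p].
   The elements [f s] are units of [S], so they act invertibly on [N]. *)
Definition is_localized_module (M : lmodType R) (N : lmodType S)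
    (g : {linear M -> N | f \; *:%R}) : Prop :=
  (forall z, exists m s u, [/\ ~ p s, u * f s = 1 & z = u *: g m]) /\
  (forall x y, g x = g y -> exists2 s, ~ p s & s *: x = s *: y).

End Localization.

Section HomModule.
Variable R : comPzRingType.

Definition lin_hom (U V : lmodType R) : Type := {linear U -> V}.

Section Structure.
Variables U V : lmodType R.

HB.instance Definition _ := gen_eqMixin (lin_hom U V).
HB.instance Definition _ := gen_choiceMixin (lin_hom U V).

Lemma lin_hom_ext (f g : lin_hom U V) : (forall x, f x = g x) -> f = g.
Proof.
case: f g => [f cf] [g cg] /= fg.
have {}fg : f = g by apply: funext.
subst g; congr GRing.Linear.Pack.
case: cf cg => [[a] [b]] [[c] [d]].
by rewrite (Prop_irrelevance a c) (Prop_irrelevance b d).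
Qed.

Definition lin_hom_zero : lin_hom U V := \0.
Definition lin_hom_opp (f : lin_hom U V) : lin_hom U V := \- f.
Definition lin_hom_add (f g : lin_hom U V) : lin_hom U V := f \+ g.
Definition lin_hom_scale (a : R) (f : lin_hom U V) : lin_hom U V := a \*: f.

Fact lin_hom_addA : associative lin_hom_add.
Proof. by move=> f g h; apply: lin_hom_ext => x /=; rewrite addrA. Qed.
Fact lin_hom_addC : commutative lin_hom_add.
Proof. by move=> f g; apply: lin_hom_ext => x /=; rewrite addrC. Qed.
Fact lin_hom_add0 : left_id lin_hom_zero lin_hom_add.
Proof. by move=> f; apply: lin_hom_ext => x /=; rewrite add0r. Qed.
Fact lin_hom_addN : left_inverse lin_hom_zero lin_hom_opp lin_hom_add.
Proof. by move=> f; apply: lin_hom_ext => x /=; rewrite addNr. Qed.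

HB.instance Definition _ :=
  GRing.isZmodule.Build (lin_hom U V)
    lin_hom_addA lin_hom_addC lin_hom_add0 lin_hom_addN.

Fact lin_hom_scaleA a b f :
  lin_hom_scale a (lin_hom_scale b f) = lin_hom_scale (a * b) f.
Proof. by apply: lin_hom_ext => x /=; rewrite scalerA. Qed.
Fact lin_hom_scale1 : left_id 1 lin_hom_scale.
Proof. by move=> f; apply: lin_hom_ext => x /=; rewrite scale1r. Qed.
Fact lin_hom_scaleDr : right_distributive lin_hom_scale +%R.
Proof. by move=> a f g; apply: lin_hom_ext => x /=; rewrite scalerDr. Qed.
Fact lin_hom_scaleDl f : {morph lin_hom_scale^~ f : a b / a + b}.
Proof. by move=> a b; apply: lin_hom_ext => x /=; rewrite scalerDl. Qed.

HB.instance Definition _ := GRing.Zmodule_isLmodule.Build R (lin_hom U V)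
  lin_hom_scaleA lin_hom_scale1 lin_hom_scaleDr lin_hom_scaleDl.

End Structure.

Definition lin_hom_pre (U V W : lmodType R) (h : {linear U -> V})
    (f : lin_hom V W) : lin_hom U W := f \o h.

Fact lin_hom_pre_linear U V W h : linear (@lin_hom_pre U V W h).
Proof. by move=> a f g; apply: lin_hom_ext. Qed.

HB.instance Definition _ U V W h :=
  GRing.isLinear.Build R (lin_hom V W) (lin_hom U W) _ (@lin_hom_pre U V W h)
    (@lin_hom_pre_linear U V W h).

End HomModule.

Section Complexes.
Variable R : comPzRingType.

(* ... -> X_2 -> X_1 -> X_0 -> 0 *)
Record chain := Chain {
  ch_obj :> nat -> lmodType R;
  ch_d : forall n, {linear ch_obj n.+1 -> ch_obj n};
  ch_dd : forall n x, ch_d n (ch_d n.+1 x) = 0 }.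

(* 0 -> X^0 -> X^1 -> X^2 -> ..., where X^n is X_{-n} in homological indexing *)
Record cochain := Cochain {
  co_obj :> nat -> lmodType R;
  co_d : forall n, {linear co_obj n -> co_obj n.+1};
  co_dd : forall n x, co_d n.+1 (co_d n x) = 0 }.

Definition is_boundary (X : chain) (n : nat) (x : X n) : Prop :=
  exists y, ch_d X n y = x.

Definition is_cycle (X : chain) (n : nat) : X n -> Prop :=
  match n with
  | 0 => fun=> True
  | m.+1 => fun x => ch_d X m x = 0
  end.

Definition is_cocycle (X : cochain) (n : nat) (x : X n) : Prop :=
  co_d X n x = 0.

Definition is_coboundary (X : cochain) (n : nat) : X n -> Prop :=
  match n with
  | 0 => fun x => x = 0
  | m.+1 => fun x => exists y, co_d X m y = x
  end.

Definition homology_zero (X : chain) (n : nat) : Prop :=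
  forall x : X n, is_cycle x -> is_boundary x.

Definition cohomology_zero (X : cochain) (n : nat) : Prop :=
  forall x : X n, is_cocycle x -> is_coboundary x.

(* Here H_0(X) is X_0 / im d, so that an isomorphism H_0(X) ~ M amounts to a
   surjection X_0 -> M whose kernel is im d. *)
Definition resolution (XX : lmodType R -> Prop) (X : chain) (M : lmodType R) :
    Prop :=
  [/\ forall n, XX (X n),
      exists e : {linear X 0%N -> M},
        (forall m, exists x, e x = m) /\
        (forall x, e x = 0 <-> is_boundary x) &
      forall n, (1 <= n)%N -> homology_zero X n].

(* Here H_0(X) is ker d, so that an isomorphism H_0(X) ~ M amounts to an
   injection M -> X^0 whose image is ker d. *)
Definition coresolution (XX : lmodType R -> Prop) (X : cochain)
    (M : lmodType R) : Prop :=
  [/\ forall n, XX (X n),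
      exists e : {linear M -> X 0%N},
        injective e /\ (forall x, is_cocycle x <-> exists m, e m = x) &
      forall n, (1 <= n)%N -> cohomology_zero X n].

(* Lengths and dimensions are computed in the extended reals, where the
   supremum and the infimum of the empty set are -oo and +oo. *)
Definition cx_length (X : nat -> lmodType R) : \bar Rdefinitions.R :=
  ereal_sup [set n%:R%:E | n in [set n | exists x : X n, x != 0]].

Definition proj_dim (XX : lmodType R -> Prop) (M : lmodType R) :
    \bar Rdefinitions.R :=
  ereal_inf
    [set e | exists2 X : chain, resolution XX X M & e = cx_length X].

Definition inj_dim (XX : lmodType R -> Prop) (M : lmodType R) :
    \bar Rdefinitions.R :=
  ereal_inf
    [set e | exists2 X : cochain, coresolution XX X M & e = cx_length X].

End Complexes.

Section HomologicalNotions.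
Variable R : comPzRingType.

Definition projective_module (P : lmodType R) : Prop :=
  forall (A B : lmodType R) (g : {linear A -> B}) (f : {linear P -> B}),
    (forall b, exists a, g a = b) ->
    exists h : {linear P -> A}, forall x, g (h x) = f x.

Definition injective_module (I : lmodType R) : Prop :=
  forall (A B : lmodType R) (g : {linear A -> B}) (f : {linear A -> I}),
    injective g -> exists h : {linear B -> I}, forall x, h (g x) = f x.

Section HomComplex.
Variables (X : chain R) (N : lmodType R).

Fact lin_hom_complex_dd n (f : lin_hom (X n) N) :
  lin_hom_pre (ch_d X n.+1) (lin_hom_pre (ch_d X n) f) = 0.
Proof. by apply: lin_hom_ext => x /=; rewrite ch_dd raddf0. Qed.

Definition lin_hom_complex : cochain R :=
  @Cochain R (fun n => lin_hom (X n) N) (fun n => lin_hom_pre (ch_d X n))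
    lin_hom_complex_dd.

End HomComplex.

(* Ext^n(M, N) = 0: projective resolutions exist, and by the comparison theorem
   the vanishing does not depend on the choice of [P]. *)
Definition Ext_zero (n : nat) (M N : lmodType R) : Prop :=
  forall P : chain R, resolution projective_module P M ->
    cohomology_zero (lin_hom_complex P N) n.

Definition finitely_generated (M : lmodType R) : Prop :=
  exists (n : nat) (g : 'I_n -> M),
    forall x, exists a : 'I_n -> R, x = \sum_(i < n) a i *: g i.

Definition homothety (C : lmodType R) (r : R) : lin_hom C C :=
  r *: (idfun : lin_hom C C).

Definition semidualizing (C : lmodType R) : Prop :=
  [/\ finitely_generated C, bijective (@homothety C) &
      forall i, (1 <= i)%N -> Ext_zero i C C].

Definition bilinear_map (U V W : lmodType R) (b : U -> V -> W) : Prop :=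
  (forall u, linear (b u)) /\ (forall v, linear (b^~ v)).

(* [T], with the bilinear map [t], is the tensor product of [U] and [V]. *)
Definition is_tensor (U V T : lmodType R) (t : U -> V -> T) : Prop :=
  bilinear_map t /\
  forall (W : lmodType R) (b : U -> V -> W), bilinear_map b ->
    exists! h : {linear T -> W}, forall u v, h (t u v) = b u v.

Definition P_ (C M : lmodType R) : Prop :=
  exists2 P : lmodType R, projective_module P &
    exists t : P -> C -> M, is_tensor t.

Definition I_ (C M : lmodType R) : Prop :=
  exists2 I : lmodType R, injective_module I &
    exists phi : {linear M -> lin_hom C I}, bijective phi.

(* [k] is, as a module, the residue field of the local ring [R]. *)
Definition residue_field (k : lmodType R) : Prop :=
  exists2 m : set R, maximal_ideal m &
    exists pi : {linear R^o -> k},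
      (forall y, exists x, pi x = y) /\ (forall x, pi x = 0 <-> m x).

Definition depth (N : lmodType R) : \bar Rdefinitions.R :=
  ereal_inf [set n%:R%:E | n in
    [set n | exists2 k : lmodType R, residue_field k & ~ Ext_zero n k N]].

Definition gorenstein_local : Prop :=
  [/\ noetherian R, local_ring R &
      (inj_dim injective_module (R^o : lmodType R) < +oo)%E].

End HomologicalNotions.

Arguments gorenstein_local R : clear implicits.
Arguments noetherian R : clear implicits.
Arguments local_ring R : clear implicits.

(* Main.v *)
Require Import Defs.
From HB Require Import structures.
From mathcomp Require Import all_boot all_order all_algebra.
From mathcomp Require Import all_classical all_reals ereal Rstruct.
From mathcomp Require Import ring.

(* Write M = Hom(C, I) with I injective, and let X be a finite P_C-resolution of
   M.  Finite depth of M_p provides e in I with annihilator p: otherwise the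
   injective Rp-module E = I / (p-torsion), which is I_p, satisfies
   Hom(k, E) = 0, and the coresolution of M_p by powers of E obtained from a free
   resolution of C kills every Ext(k, M_p).

   Since Ext(C, P (x) C) = 0 in positive degrees, every map from C to M lifts to
   X_0, and Hom(C, C) = R then makes the evaluation of C (x) Hom(C, M) in M
   injective.  Hence there is an endomorphism of M sending b(c, -) to b(-, c) for
   every bilinear map b from C x C to I.  Two elements of a minimal generating
   set of C_p would give linear forms x, y and a form b = x y e on which this is
   impossible; so C_p is cyclic, and faithful, i.e. C_p = R_p.

   Now M_p = I_p has a finite flat resolution, so Tor_n(R/J, I)_p = 0 for n large,
   uniformly in the ideal J.  Elements of I annihilated exactly by p detect
   nonzero classes, so this gives Ext^n(R/J, R)_p = 0 by injectivity of I.  As E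
   is an injective cogenerator over Rp, Rp has an injective coresolution, of which
   Baer's criterion shows some cosyzygy to be injective. *)

Set Implicit Arguments.
Unset Strict Implicit.
Unset Printing Implicit Defensive.

Import Order.TTheory GRing.Theory Num.Theory.

Local Open Scope classical_set_scope.
Local Open Scope ring_scope.

(** * Submodules and quotient modules *)

(** [Rp] and [Mp] are known only through fractions, and [P_ C] only through a universal property. So
    most of the work happens over [R]: localized statements hold up to a factor outside [p],
    finitely many such factors being merged into one, and a module of [P_ C] enters only through the
    fact that its identity agrees, on finitely many elements, with a sum of maps through [C].
    Matrices of finite free resolutions carry both Hom and tensor product. Finite depth contributes
    [e] alone, which serves three times: it keeps the form x y e nonzero, it detects Ext classes,
    and it makes E a cogenerator. Once C_p is free of rank one, the modules of X are locally flat,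
    and dimension shifting along X gives a bound that depends on the length of X only. This is why
    one cosyzygy passes Baer's test for all ideals at once. *)

Lemma linear_map_exists (R S : pzRingType) (U : lmodType R) (V : zmodType)
    (s : GRing.Scale.law R V) (f : U -> V) :
  linear_for s f -> exists F : {linear U -> V | s}, forall x, F x = f x.
Proof.
move=> lf.
pose F : {linear U -> V | s} := HB.pack f (GRing.isLinear.Build R U V s f lf).
by exists F.
Qed.

Section Submodules.
Variable R : comPzRingType.

Definition submodule (V : lmodType R) (U : set V) : Prop :=
  [/\ U 0, forall x y, U x -> U y -> U (x + y) & forall a x, U x -> U (a *: x)].

Lemma submoduleB (V : lmodType R) (U : set V) x y :
  submodule U -> U x -> U y -> U (x - y).
Proof.
by case=> _ UD UZ Ux Uy; rewrite -scaleN1r; apply: UD => //; apply: UZ.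
Qed.

Lemma submodule_sum (V : lmodType R) (U : set V) (J : finType) (F : J -> V) :
  submodule U -> (forall j, U (F j)) -> U (\sum_j F j).
Proof. by case=> U0 UD _ UF; apply: (big_ind U). Qed.

Section Subquotient.
Variables (V : lmodType R) (D U : set V).
Hypotheses (sD : submodule D) (sU : submodule U) (UD : U `<=` D).

(** The choice depends only on the set of candidates, which congruent elements share; so quotients
    can be made of representatives instead of classes. *)
Definition coset_rep (v : V) : V := xget 0 [set w | U (w - v)].

Lemma coset_repP v : U (coset_rep v - v).
Proof.
rewrite /coset_rep; case: xgetP => [w -> //|/(_ v)[]].
by rewrite /= subrr; case: sU.
Qed.

Lemma coset_rep_eq v w : U (v - w) -> coset_rep v = coset_rep w.
Proof.
move=> Uvw; rewrite /coset_rep; congr xget; apply/seteqP; split=> x /= Ux.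
  by rewrite -(subrK v x) -addrA; case: sU => _ /(_ _ _ Ux Uvw).
by rewrite -(subrKA w) -(opprB v w); apply: submoduleB.
Qed.

Lemma coset_rep_in v : D v -> D (coset_rep v).
Proof.
move=> Dv; rewrite -(subrK v (coset_rep v)); case: sD => _ DD _.
by apply: DD => //; apply/UD/coset_repP.
Qed.

Lemma coset_rep_id v : coset_rep (coset_rep v) = coset_rep v.
Proof. by apply/coset_rep_eq/coset_repP. Qed.

(** One construction for two uses: [U] zero gives submodules, [D] everything gives quotients. *)
Definition subquotient of submodule D & submodule U & U `<=` D : Type :=
  {v | `[< D v >] && (coset_rep v == v)}.

Local Notation Q := (subquotient sD sU UD).

Fact subquotient_proof v : D v -> `[< D (coset_rep v) >] &&
  (coset_rep (coset_rep v) == coset_rep v).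
Proof. by move=> /coset_rep_in/asboolP ->; rewrite coset_rep_id eqxx. Qed.

Definition to_subquotient v (Dv : D v) : Q :=
  exist (fun v => `[< D v >] && (coset_rep v == v)) _ (subquotient_proof Dv).

Lemma subquotient_in (x : Q) : D (val x).
Proof. by case: x => v /= /andP[/asboolP]. Qed.

Lemma subquotient_rep (x : Q) : coset_rep (val x) = val x.
Proof. by case: x => v /= /andP[_ /eqP]. Qed.

HB.instance Definition _ := gen_eqMixin Q.
HB.instance Definition _ := gen_choiceMixin Q.

Lemma subquotient_inj (x y : Q) : U (val x - val y) -> x = y.
Proof.
move=> /coset_rep_eq; rewrite !subquotient_rep; case: x y => x hx [y hy] /= xy.
by subst y; congr exist; apply: Prop_irrelevance.
Qed.

Lemma in_D0 : D 0. Proof. by case: sD. Qed.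
Lemma in_DD (x y : Q) : D (val x + val y).
Proof. by case: sD => _ h _; apply: h; apply: subquotient_in. Qed.
Lemma in_DZ a (x : Q) : D (a *: val x).
Proof. by case: sD => _ _ h; apply: h; apply: subquotient_in. Qed.
Lemma in_DN (x : Q) : D (- val x).
Proof. by rewrite -scaleN1r; apply: in_DZ. Qed.

Definition sq0 : Q := to_subquotient in_D0.
Definition sq_opp x : Q := to_subquotient (in_DN x).
Definition sq_add x y : Q := to_subquotient (in_DD x y).
Definition sq_scale a x : Q := to_subquotient (in_DZ a x).

Definition sq_cong (x y : V) := U (x - y).
Lemma sq_cong_refl x : sq_cong x x. Proof. by rewrite /sq_cong subrr; case: sU. Qed.
Lemma sq_congD x y x' y' : sq_cong x x' -> sq_cong y y' -> sq_cong (x + y) (x' + y').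
Proof. by rewrite /sq_cong opprD addrACA; case: sU => _ + _; apply. Qed.
Lemma sq_congZ a x y : sq_cong x y -> sq_cong (a *: x) (a *: y).
Proof. by rewrite /sq_cong -scalerBr; case: sU => _ _; apply. Qed.
Lemma sq_cong_sym x y : sq_cong x y -> sq_cong y x.
Proof. by move/(sq_congZ (-1)); rewrite /sq_cong !scaleN1r opprK addrC. Qed.
Lemma sq_cong_trans y x z : sq_cong x y -> sq_cong y z -> sq_cong x z.
Proof. by move=> /sq_congD h /h; rewrite /sq_cong opprD addrA addrK. Qed.
Lemma sq_cong_rep x : sq_cong (coset_rep x) x. Proof. exact: coset_repP. Qed.

Fact sq_addA : associative sq_add.
Proof.
move=> x y z; apply/subquotient_inj/(sq_cong_trans (sq_cong_rep _)) => /=.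
apply: sq_cong_trans (sq_congD (sq_cong_refl _) (sq_cong_rep _)) _; rewrite addrA.
apply/sq_cong_sym/(sq_cong_trans (sq_cong_rep _))/sq_congD; [exact: sq_cong_rep|exact: sq_cong_refl].
Qed.
Fact sq_addC : commutative sq_add.
Proof.
move=> x y; apply/subquotient_inj/(sq_cong_trans (sq_cong_rep _)) => /=.
by rewrite addrC; apply/sq_cong_sym/sq_cong_rep.
Qed.
Fact sq_add0 : left_id sq0 sq_add.
Proof.
move=> x; apply/subquotient_inj/(sq_cong_trans (sq_cong_rep _)) => /=.
by rewrite -[X in sq_cong _ X]add0r; apply/sq_congD/sq_cong_refl/sq_cong_rep.
Qed.
Fact sq_addN : left_inverse sq0 sq_opp sq_add.
Proof.
move=> x; apply/subquotient_inj/(sq_cong_trans (sq_cong_rep _)) => /=.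
apply: sq_cong_trans (sq_congD (sq_cong_rep _) (sq_cong_refl _)) _.
by rewrite addNr; apply/sq_cong_sym/sq_cong_rep.
Qed.

HB.instance Definition _ :=
  GRing.isZmodule.Build Q sq_addA sq_addC sq_add0 sq_addN.

Fact sq_scaleA a b x : sq_scale a (sq_scale b x) = sq_scale (a * b) x.
Proof.
apply/subquotient_inj/(sq_cong_trans (sq_cong_rep _)) => /=.
apply: sq_cong_trans (sq_congZ _ (sq_cong_rep _)) _.
by rewrite scalerA; apply/sq_cong_sym/sq_cong_rep.
Qed.
Fact sq_scale1 : left_id 1 sq_scale.
Proof.
move=> x; apply/subquotient_inj/(sq_cong_trans (sq_cong_rep _)) => /=.
by rewrite scale1r; apply: sq_cong_refl.
Qed.
Fact sq_scaleDr : right_distributive sq_scale +%R.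
Proof.
move=> a x y; apply/subquotient_inj/(sq_cong_trans (sq_cong_rep _)) => /=.
apply: sq_cong_trans (sq_congZ _ (sq_cong_rep _)) _; rewrite scalerDr.
by apply/sq_cong_sym/(sq_cong_trans (sq_cong_rep _))/sq_congD; apply: sq_cong_rep.
Qed.
Fact sq_scaleDl x : {morph sq_scale^~ x : a b / a + b}.
Proof.
move=> a b; apply/subquotient_inj/(sq_cong_trans (sq_cong_rep _)) => /=; rewrite scalerDl.
by apply/sq_cong_sym/(sq_cong_trans (sq_cong_rep _))/sq_congD; apply: sq_cong_rep.
Qed.
HB.instance Definition _ := GRing.Zmodule_isLmodule.Build R Q
  sq_scaleA sq_scale1 sq_scaleDr sq_scaleDl.

Lemma val_sq_linear a (x y : Q) : U (val (a *: x + y) - (a *: val x + val y)).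
Proof.
by apply: (sq_cong_trans (sq_cong_rep _)) (sq_congD (sq_cong_rep _) (sq_cong_refl _)).
Qed.

End Subquotient.

Lemma submodule0 (V : lmodType R) : submodule [set 0 : V].
Proof.
split=> //= [x y -> ->|a x ->]; first by rewrite addr0.
by rewrite scaler0.
Qed.

Lemma submoduleT (V : lmodType R) : submodule [set: V]. Proof. by []. Qed.

Lemma submodule_module (V : lmodType R) (D : set V) : submodule D ->
  exists (A : lmodType R) (i : {linear A -> V}), injective i /\ range i = D.
Proof.
move=> sD; have D0 : [set 0] `<=` D by move=> _ ->; case: sD.
pose i (x : subquotient sD (submodule0 V) D0) : V := val x.
have [|F FE] := @linear_map_exists R R _ V *:%R i.
  by move=> a x y; apply/eqP; rewrite -subr_eq0; apply/eqP/(val_sq_linear (UD := D0)).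
exists (subquotient sD (submodule0 V) D0), F; split.
  move=> x y; rewrite !FE => /eqP; rewrite -subr_eq0 => /eqP xy.
  exact: subquotient_inj.
apply/seteqP; split=> [_ [x _ <-]|x Dx].
  by rewrite FE; apply: subquotient_in.
exists (@to_subquotient V D _ sD (submodule0 V) D0 x Dx) => //; rewrite FE.
by apply/eqP; rewrite -subr_eq0; apply/eqP/(coset_repP (submodule0 V)).
Qed.

Lemma quotient_module (V : lmodType R) (U : set V) : submodule U ->
  exists (Q : lmodType R) (pi : {linear V -> Q}),
    (forall q, exists x, pi x = q) /\ (forall x, pi x = 0 <-> U x).
Proof.
move=> sU; have UT : U `<=` [set: V] by [].
pose pi (x : V) : subquotient (submoduleT V) sU UT :=
  @to_subquotient V _ U (submoduleT V) sU UT x I.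
have piE x y : U (x - y) -> pi x = pi y.
  move=> Uxy; apply: subquotient_inj => /=.
  by rewrite (coset_rep_eq sU Uxy) subrr; case: (sU).
have [|F FE] := @linear_map_exists R R V _ *:%R pi.
  move=> a x y; apply: subquotient_inj.
  apply: (sq_cong_trans sU (sq_cong_rep sU _)).
  apply/(sq_cong_sym sU)/(sq_cong_trans sU (sq_cong_rep sU _)).
  apply: (sq_congD sU) (sq_cong_rep sU _).
  by apply: (sq_cong_trans sU (sq_cong_rep sU _)) (sq_congZ sU _ (sq_cong_rep sU _)).
exists (subquotient (submoduleT V) sU UT), F; split=> [q|x].
  by exists (val q); rewrite FE; apply/subquotient_inj/(sq_cong_rep sU).
rewrite FE; split=> [|Ux]; last first.
  by rewrite -(linear0 F) FE; apply: piE; rewrite subr0.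
rewrite -(linear0 F) FE => /(congr1 val) /= xE.
have := coset_repP sU x; rewrite xE => h.
rewrite -(subr0 x); apply: (sq_cong_trans sU) (sq_cong_rep sU 0).
exact: (sq_cong_sym sU).
Qed.

End Submodules.

(** * Injective modules and Baer's criterion *)

Section Injectives.
Variable R : comPzRingType.

(** Partial linear maps are handled as submodules [G] of [B * W]; single-valuedness then needs
    testing over 0 only. *)
Definition functional_rel (B W : lmodType R) (G : set (B * W)) : Prop :=
  forall y, G (0, y) -> y = 0.

Lemma functional_relE (B W : lmodType R) (G : set (B * W)) x y z :
  submodule G -> functional_rel G -> G (x, y) -> G (x, z) -> y = z.
Proof.
move=> sG fG Gy Gz; apply/eqP; rewrite -subr_eq0; apply/eqP/fG.
by rewrite -(subrr x); apply: (submoduleB sG Gy Gz).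
Qed.

Lemma functional_linear (B W : lmodType R) (G : set (B * W)) :
  submodule G -> functional_rel G -> (forall x, exists y, G (x, y)) ->
  exists H : {linear B -> W}, forall x y, G (x, y) -> H x = y.
Proof.
move=> sG fG /choice[h hG]; have hE x y : G (x, y) -> h x = y.
  exact: functional_relE.
have [|H HE] := @linear_map_exists R R B W *:%R h.
  move=> a x y; apply: hE; case: sG => _ GD GZ.
  exact: GD (GZ a _ (hG x)) (hG y).
by exists H => x y /hE; rewrite HE.
Qed.

Lemma linear_factor (A B W : lmodType R) (g : {linear A -> B})
    (f : {linear A -> W}) :
  (forall b, exists a, g a = b) -> (forall a, g a = 0 -> f a = 0) ->
  exists h : {linear B -> W}, forall a, h (g a) = f a.
Proof.
move=> gS gf; pose G := [set z : B * W | exists a, z = (g a, f a)].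
have [||x|h hG] := @functional_linear B W G.
- split=> [|_ _ [a ->] [b ->]|c _ [a ->]]; first by exists 0; rewrite !linear0.
    by exists (a + b); rewrite !linearD.
  by exists (c *: a); rewrite !linearZ.
- by move=> y [a [/esym/gf ? ->]].
- by have [a <-] := gS x; exists (f a), a.
by exists h => a; apply: hG; exists a.
Qed.

Lemma injective_extend (B W : lmodType R) (G : set (B * W)) :
  injective_module W -> submodule G -> functional_rel G ->
  exists H : {linear B -> W}, forall x y, G (x, y) -> H x = y.
Proof.
move=> injW sG fG; have [A [i [injI rI]]] := submodule_module sG.
have [|h hE] := injW A B (fst \o i) (snd \o i).
  move=> x y /= xy; apply: injI.
  have Gi z : G (i z) by rewrite -rI; exists z.
  have := Gi x; have := Gi y; case: (i x) (i y) xy => [x1 x2] [y1 y2] /= -> Gy Gx.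
  by congr pair; apply: functional_relE Gx Gy.
exists h => x y; rewrite -rI => -[a _ ai].
by have := hE a; rewrite /= ai.
Qed.

(** The domain of [G] is an ideal, and [w] is the value at 1 of an extension to [R]. *)
Definition baer (W : lmodType R) : Prop :=
  forall G : set (R^o * W), submodule G -> functional_rel G ->
  exists w, forall x y, G (x, y) -> y = x *: w.

Section BaerCriterion.
Variables (B W : lmodType R) (G0 : set (B * W)).
Hypotheses (baerW : baer W) (sG0 : submodule G0) (fG0 : functional_rel G0).

(** Zorn's lemma also tests the empty chain, whose union is empty; joining [G0] to every [X] covers
    that case. *)
Let P (X : set (B * W)) := submodule (X `|` G0) /\ functional_rel (X `|` G0).

Lemma baer_chain (F : set (set (B * W))) :
  F `<=` P -> total_on F subset -> P (\bigcup_(X in F) X).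
Proof.
move=> FP Ft; set Y := \bigcup_(X in F) X.
have P0 : P set0 by rewrite /P set0U.
have two a b : (Y `|` G0) a -> (Y `|` G0) b -> exists Z : set (B * W),
    [/\ P Z, (Z `|` G0) a, (Z `|` G0) b & Z `<=` Y].
  case=> [[X FX Xa]|Ga] [[X' FX' Xb]|Gb].
  - case: (Ft _ _ FX FX') => XX.
      exists X'; split; [exact: FP|by left; apply: XX|by left|].
      by move=> z ?; exists X'.
    exists X; split; [exact: FP|by left|by left; apply: XX|].
    by move=> z ?; exists X.
  - exists X; split; [exact: FP|by left|by right|].
    by move=> z ?; exists X.
  - exists X'; split; [exact: FP|by right|by left|].
    by move=> z ?; exists X'.
  - by exists set0; split=> //; right.
split; first split.
- by right; case: sG0.
- move=> a b Ya Yb; have [Z [[sZ _] Za Zb ZY]] := two _ _ Ya Yb.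
  by case: sZ => _ /(_ _ _ Za Zb) + _; case=> [/ZY|]; [left|right].
- move=> c a Ya; have [Z [[sZ _] Za _ ZY]] := two _ _ Ya Ya.
  by case: sZ => _ _ /(_ c _ Za) [/ZY|]; [left|right].
- by move=> y Yy; have [Z [[_ fZ] Zy _ _]] := two _ _ Yy Yy; apply: fZ.
Qed.

Lemma baer_extend :
  exists H : {linear B -> W}, forall x y, G0 (x, y) -> H x = y.
Proof.
have [X [[sY fY] maxX]] := Zorn_bigcup baer_chain.
set Y := X `|` G0 in sY fY.
have maxY Z : submodule Z -> functional_rel Z -> Y `<=` Z -> Z `<=` Y.
  move=> sZ fZ YZ; apply: contrapT => ZY.
  have ZE : Z `|` G0 = Z by apply/setUidPl => z Gz; apply: YZ; right.
  suff XZ : X `<` Z by apply: (maxX Z XZ); rewrite /P ZE.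
  split; last by move=> ZX; apply: ZY => z /ZX; left.
  by move=> z Xz; apply: YZ; left.
have [Y0 YD YZ] := sY.
suff Yt b : exists y, Y (b, y).
  have [H HY] := functional_linear sY fY Yt.
  by exists H => x y Gxy; apply: HY; right.
have [|y|w0 w0P] := baerW (G := [set z : R^o * W | Y (z.1 *: b, z.2)]).
- split=> /= [|x y Yx Yy|a x Yx]; first by rewrite scale0r.
    by rewrite scalerDl; apply: (YD _ _ Yx Yy).
  by rewrite -scalerA; apply: (YZ a _ Yx).
- by rewrite /= scale0r => /fY.
(* This is [Y] + R([b], [w0]). The choice of [w0] makes it functional, and maximality then puts [b]
   in the domain of [Y]. *)
pose Z : set (B * W) :=
  [set z | exists u v r, Y (u, v) /\ z = (u + r *: b, v + r *: w0)].
exists w0; apply: (maxY Z).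
- split=> [|_ _ [u [v [r [Yu ->]]]] [u' [v' [r' [Yu' ->]]]]|a _ [u [v [r [Yu ->]]]]].
  + by exists 0, 0, 0; split=> //; rewrite !scale0r !addr0.
  + exists (u + u'), (v + v'), (r + r'); split; first exact: (YD _ _ Yu Yu').
    by rewrite !scalerDl; congr pair; rewrite /= addrACA.
  + exists (a *: u), (a *: v), (a * r); split; first exact: (YZ a _ Yu).
    by congr pair; rewrite /= scalerDr scalerA.
- move=> y [u [v [r [Yu [/esym/eqP]]]]].
  rewrite addrC addr_eq0 => /eqP rb ->.
  have: Y (r *: b, - v) by rewrite rb; have := YZ (-1) _ Yu; rewrite /= -!scaleN1r.
  by move/w0P => /= <-; rewrite subrr.
- by move=> [u v] Yu; exists u, v, 0; rewrite !scale0r !addr0.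
- by exists 0, 0, 1; rewrite !scale1r !add0r.
Qed.

End BaerCriterion.

Lemma baer_injective (W : lmodType R) : baer W -> injective_module W.
Proof.
move=> bW A B g f ginj.
have [||h hE] := @baer_extend B W [set z | exists a, z = (g a, f a)] bW.
- split=> [|_ _ [a ->] [b ->]|c _ [a ->]]; first by exists 0; rewrite !linear0.
    by exists (a + b); rewrite !linearD.
  by exists (c *: a); rewrite !linearZ.
- by move=> y [a [/esym ga ->]]; rewrite -(linear0 g) in ga; rewrite (ginj _ _ ga) linear0.
by exists h => x; apply: hE; exists x.
Qed.

Lemma injective_fun (T : Type) (W : lmodType R) :
  injective_module W -> injective_module (T -> W).
Proof.
move=> iW A B g f ginj.
have /choice[h hE] (t : T) : exists h : {linear B -> W}, forall x, h (g x) = f x t.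
  have [|ft ftE] := @linear_map_exists R R A W *:%R (fun x => f x t).
    by move=> a x y; rewrite linearP.
  by have [h hE] := iW A B g ft ginj; exists h => x; rewrite hE ftE.
have [|H HE] := @linear_map_exists R R B (T -> W) *:%R (fun b t => h t b).
  by move=> a x y; apply/funext => t; rewrite linearP.
by exists H => x; rewrite HE; apply/funext => t; rewrite hE.
Qed.

Lemma injective_trivial (W : lmodType R) :
  (forall w : W, w = 0) -> injective_module W.
Proof.
move=> W0 A B g f _; exists \0 => x; by rewrite [LHS]W0 [RHS]W0.
Qed.

End Injectives.

Section RowVectors.
Variable R : comPzRingType.

Definition lincomb (V : lmodType R) n (v : 'I_n -> V) (x : 'rV[R]_n) : V :=
  \sum_i x 0 i *: v i.

Lemma lincomb_linear (V : lmodType R) n (v : 'I_n -> V) : linear (lincomb v).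
Proof.
move=> a x y; rewrite /lincomb scaler_sumr -big_split; apply: eq_bigr => i _.
by rewrite !mxE scalerDl scalerA.
Qed.

HB.instance Definition _ (V : lmodType R) n (v : 'I_n -> V) :=
  GRing.isLinear.Build R 'rV[R]_n V _ (lincomb v) (lincomb_linear v).

Lemma lincomb_delta (V : lmodType R) n (v : 'I_n -> V) i :
  lincomb v (delta_mx 0 i) = v i.
Proof.
rewrite /lincomb (bigD1 i) //= big1 => [|j ji]; rewrite mxE eqxx /=.
  by rewrite eqxx scale1r addr0.
by rewrite (negPf ji) scale0r.
Qed.

Lemma linear_lincomb (V W : lmodType R) n (f : {linear V -> W}) (v : 'I_n -> V) x :
  f (lincomb v x) = lincomb (f \o v) x.
Proof. by rewrite /lincomb linear_sum; apply: eq_bigr => i _; rewrite linearZ. Qed.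

Lemma row_linearE (V : lmodType R) n (f : {linear 'rV[R]_n -> V}) x :
  f x = lincomb (fun i => f (delta_mx 0 i)) x.
Proof.
rewrite {1}(row_sum_delta x) linear_sum.
by apply: eq_bigr => i _; rewrite linearZ.
Qed.

Lemma projective_row n : projective_module 'rV[R]_n.
Proof.
move=> A B g f gS.
have /choice[v vE] i : exists a, g a = f (delta_mx 0 i) by apply: gS.
exists (lincomb v) => x; rewrite linear_lincomb [RHS]row_linearE.
by congr lincomb; apply/funext => i /=.
Qed.

End RowVectors.

(** * Resolutions by finite free modules *)

Section MatrixResolutions.
Variable R : comPzRingType.

(** Exactness starts in degree 1, so the resolved module, the cokernel of [dmx 0], need not be
    named. Matrices act on rows from the right. *)
Record matrix_resolution := MatrixResolution {
  rk : nat -> nat;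
  dmx : forall n, 'M[R]_(rk n.+1, rk n);
  mx_exact : forall n (x : 'rV[R]_(rk n.+1)),
    x *m dmx n = 0 <-> exists y, x = y *m dmx n.+1 }.

Lemma mx_mx (F : matrix_resolution) n : dmx F n.+1 *m dmx F n = 0.
Proof.
apply/row_matrixP => i; rewrite row_mul row0; apply/mx_exact.
by exists (delta_mx 0 i); rewrite rowE.
Qed.

Fact mx_chain_dd (F : matrix_resolution) n (x : 'rV[R]_(rk F n.+2)) :
  mulmxr (dmx F n) (mulmxr (dmx F n.+1) x) = 0 :> 'rV[R]_(rk F n).
Proof. by rewrite /= -mulmxA mx_mx mulmx0. Qed.

Definition mx_chain (F : matrix_resolution) : chain R :=
  @Chain R (fun n => 'rV[R]_(rk F n)) (fun n => mulmxr (dmx F n)) (@mx_chain_dd F).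

Hypothesis noethR : noetherian R.

(** Induction on [n]: the first coordinates form an ideal, and subtracting lifts [X] of its
    generators brings an element of [U] to first coordinate 0, hence into [U']. *)
Lemma submodule_row_fg n (U : set 'rV[R]_n) : submodule U ->
  exists m (A : 'M[R]_(m, n)), forall x, U x <-> exists y, x = y *m A.
Proof.
elim: n U => [|n IHn] U sU.
  exists 0%N, 0 => x; split=> _; first by exists 0; apply/rowP => -[].
  by rewrite (_ : x = 0); [case: sU|apply/rowP => -[]].
have [U0 UD UZ] : submodule (U : set 'rV[R]_(1 + n)) := sU.
pose J : set R := [set a | exists2 x, U x & x 0 0 = a].
have [|m [g JE]] := noethR (I := J).
  split; first by exists 0; rewrite ?mxE.
    by move=> _ _ [x Ux <-] [y Uy <-]; exists (x + y); rewrite ?mxE //; apply: UD.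
  by move=> a _ [x Ux <-]; exists (a *: x); rewrite ?mxE //; apply: UZ.
have /choice[X XP] i : exists x, U x /\ x 0 0 = g i.
  have : J (g i).
    rewrite JE; exists (fun j => (j == i)%:R) => //.
    rewrite (bigD1 i) //= eqxx mul1r big1 ?addr0 // => j ji.
    by rewrite (negPf ji) mul0r.
  by case=> x; exists x.
pose U' : set 'rV[R]_n := [set x | U (row_mx (0 : 'rV_1) x)].
have [|m' [A' A'P]] := IHn U'.
  split=> [|x y Ux Uy|a x Ux]; rewrite /U' /=.
  - by rewrite row_mx0.
  - by have := UD _ _ Ux Uy; rewrite add_row_mx addr0.
  - by have := UZ a _ Ux; rewrite scale_row_mx scaler0.
pose XA : 'M[R]_(m, 1 + n) := \matrix_i X i.
have UXA y : U (y *m XA).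
  rewrite mulmx_sum_row; apply: submodule_sum => // i.
  by apply: UZ; rewrite rowK; case: (XP i).
exists (m + m')%N, (col_mx XA (row_mx 0 A')) => x; split=> [Ux|[y ->]]; last first.
  rewrite -[y]hsubmxK mul_row_col; apply: UD; first exact: UXA.
  have -> : rsubmx y *m row_mx 0 A' = row_mx (0 : 'rV_1) (rsubmx y *m A').
    by rewrite (@mul_mx_row _ _ _ 1 n) mulmx0.
  by apply/A'P; exists (rsubmx y).
have : J (x 0 0) by exists x.
rewrite JE => -[a _ aE].
pose y : 'rV[R]_m := \row_i a i.
have yE : (y *m XA) 0 0 = x 0 0.
  rewrite mxE -aE; apply: eq_bigr => i _; rewrite !mxE.
  by case: (XP i) => _ <-.
have Uz : U (x - y *m XA) by apply: submoduleB.
have zE : x - y *m XA = row_mx (0 : 'rV_1) (rsubmx (x - y *m XA : 'rV_(1 + n))).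
  rewrite -[LHS](@hsubmxK _ _ 1 n); suff -> : @lsubmx _ 1 1 n (x - y *m XA) = 0 by [].
  apply/rowP => i; rewrite (ord1 i) [LHS]mxE (_ : lshift n 0 = 0); last exact: val_inj.
  by rewrite mxE [X in _ + X]mxE yE subrr mxE.
move: Uz; rewrite zE => /A'P[w wE].
exists (row_mx y w); rewrite mul_row_col (@mul_mx_row _ _ _ 1 n) mulmx0 -wE -zE.
by rewrite addrC subrK.
Qed.

Lemma syzygies_exist m k (A : 'M[R]_(m, k)) :
  exists B : {m' & 'M[R]_(m', m)},
    forall x : 'rV[R]_m, x *m A = 0 <-> exists y, x = y *m projT2 B.
Proof.
have [|m' [B BP]] := @submodule_row_fg m [set x | x *m A = 0].
  split=> [|x y /= xA yA|a x /= xA]; rewrite /= ?mul0mx //.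
    by rewrite mulmxDl xA yA addr0.
  by rewrite -scalemxAl xA scaler0.
by exists (existT _ m' B).
Qed.

Record mx_state := MxState { st_col : nat; st_row : nat;
  st_mx : 'M[R]_(st_row, st_col) }.

Definition syzygies (s : mx_state) := cid (syzygies_exist (st_mx s)).

Definition next_state (s : mx_state) : mx_state :=
  MxState (projT2 (sval (syzygies s))).

(* The recursion on states makes [rk 0], [rk 1] and [dmx 0] of the resolution
   reduce to [k], [m] and [A]. *)
Section FreeResolution.
Variables (m k : nat) (A : 'M[R]_(m, k)).

Definition state n : mx_state := iter n next_state (MxState A).

Definition free_resolution : matrix_resolution :=
  @MatrixResolution (fun n => st_col (state n)) (fun n => st_mx (state n))
    (fun n => svalP (syzygies (state n))).

End FreeResolution.

Lemma fg_resolution (V : lmodType R) k (v : 'I_k -> V) :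
  exists F : matrix_resolution, exists e : {linear 'rV[R]_(rk F 0) -> V},
    (range e = range (lincomb v)) /\
    (forall x, e x = 0 <-> exists y, x = y *m dmx F 0).
Proof.
have [|m [A AP]] := @submodule_row_fg k [set x | lincomb v x = 0].
  split=> [|x y /= x0 y0|a x /= x0]; rewrite /= ?linear0 //.
    by rewrite linearD /= x0 y0 addr0.
  by rewrite linearZ /= x0; apply: scaler0.
by exists (free_resolution A), (lincomb v).
Qed.

Lemma fg_projective_resolution (V : lmodType R) (F : matrix_resolution)
    (e : {linear 'rV[R]_(rk F 0) -> V}) :
  (forall c, exists x, e x = c) ->
  (forall x, e x = 0 <-> exists y, x = y *m dmx F 0) ->
  resolution (@projective_module R) (mx_chain F) V.
Proof.
move=> eS eK; split.
- by move=> n; apply: projective_row.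
- exists e; split=> // x; rewrite eK.
  by split=> -[y yE]; exists y; apply: esym.
- move=> [//|n] _ x /= /mx_exact[y ->]; by exists y.
Qed.

End MatrixResolutions.

Lemma common_multiplier (R : comPzRingType) (p : set R) (J : finType)
    (Q : J -> R -> Prop) :
  prime_ideal p -> (forall j a s, Q j s -> Q j (a * s)) ->
  (forall j, exists2 s, ~ p s & Q j s) ->
  exists2 s, ~ p s & forall j, Q j s.
Proof.
move=> [_ p1 pM] QM sQ.
have /choice[s sP] j : exists s, ~ p s /\ Q j s by have [s] := sQ j; exists s.
exists (\prod_j s j) => [|j].
  by apply: (big_ind (fun s => ~ p s)) => // [x y px py /pM[]//|j _]; case: (sP j).
by rewrite (bigD1 j) //= mulrC; apply: QM; case: (sP j).
Qed.

(** * Modules in P_C *)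

Section Approximation.
Variable R : comPzRingType.

Definition supported_on (K : eqType) (V : zmodType) (r : seq K) (f : K -> V) :=
  forall y, y \notin r -> f y = 0.

Lemma supported_sum (K : choiceType) (V : zmodType) (r r' : seq K) (F : K -> V) :
  uniq r -> uniq r' -> supported_on r F -> supported_on r' F ->
  \sum_(y <- r) F y = \sum_(y <- r') F y.
Proof.
by move=> ur ur' Fr Fr'; rewrite !bigfs // => y _; [apply: Fr'|apply: Fr].
Qed.

Lemma supported_catl (K : eqType) (V : zmodType) (r r' : seq K) (F : K -> V) :
  supported_on r F -> supported_on (undup (r ++ r')) F.
Proof.
by move=> Fr y; rewrite mem_undup mem_cat negb_or => /andP[/Fr].
Qed.

Lemma supported_catr (K : eqType) (V : zmodType) (r r' : seq K) (F : K -> V) :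
  supported_on r' F -> supported_on (undup (r ++ r')) F.
Proof.
by move=> Fr y; rewrite mem_undup mem_cat negb_or => /andP[_ /Fr].
Qed.

(** Finitely supported functions on [K]. The value of [q] can be read off any duplicate-free list
    covering the support, so that supports may be enlarged at will. *)
Lemma free_module (K : choiceType) :
  exists (A : lmodType R) (i : {linear A -> (K -> R^o)}),
    (forall a, exists2 r : seq K, uniq r & supported_on r (i a)) /\
    forall (V : lmodType R) (v : K -> V), exists q : {linear A -> V},
      (forall k, exists a, q a = v k) /\
      (forall a r, uniq r -> supported_on r (i a) ->
        q a = \sum_(y <- r) i a y *: v y).
Proof.
pose D : set (K -> R^o) := [set f | exists2 r : seq K, uniq r & supported_on r f].
have sD : submodule D.
  split=> [|f g [r ur rf] [r' ur' rg]|a f [r ur rf]].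
  - by exists [::].
  - exists (undup (r ++ r')); first exact: undup_uniq.
    move=> y yr; rewrite /= [(f + g) y]/(f y + g y).
    by rewrite (supported_catl rf yr) (supported_catr rg yr); exact: addr0.
  - exists r => // y yr; rewrite [(a *: f) y]/(a *: f y).
    by rewrite (rf _ yr); exact: scaler0.
have [A [i [inji ri]]] := submodule_module sD.
have iD a : D (i a) by rewrite -ri; exists a.
exists A, i; split=> // V v.
pose G : set (A * V) := [set z | exists2 r : seq K, uniq r /\
  supported_on r (i z.1) & z.2 = \sum_(y <- r) i z.1 y *: v y].
have sv r a : supported_on r (i a) -> supported_on r (fun y => i a y *: v y).
  by move=> ra y /ra ->; rewrite scale0r.
have [|||q qG] := @functional_linear R A V G.
- split=> [|[a x] [b z] [r [ur ra] /= ->] [r' [ur' rb] /= ->]|c [a x] [r [ur ra] /= ->]].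
  + by exists [::]; rewrite ?big_nil //=; split=> // y; rewrite linear0.
  + have u := undup_uniq (r ++ r').
    have ab : supported_on (undup (r ++ r')) (i (a + b)).
      move=> y yr; rewrite linearD [(_ + _) y]/(i a y + i b y).
      by rewrite (supported_catl ra yr) (supported_catr rb yr); exact: addr0.
    exists (undup (r ++ r')) => //=.
    rewrite (supported_sum ur u (sv _ _ ra) (sv _ _ (supported_catl ra))).
    rewrite (supported_sum ur' u (sv _ _ rb) (sv _ _ (supported_catr rb))).
    rewrite -big_split; apply: eq_bigr => y _ /=.
    by rewrite -scalerDl linearD.
  + exists r; first split=> //= y yr.
      by rewrite linearZ [LHS]/(c *: i a y) (ra _ yr); exact: scaler0.
    rewrite /= scaler_sumr; apply: eq_bigr => y _ /=.
    by rewrite scalerA linearZ.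
- move=> x [r [ur ra] /= ->]; rewrite big1 // => y _.
  by rewrite linear0 scale0r.
- by move=> a; have [r ur ra] := iD a; exists (\sum_(y <- r) i a y *: v y), r.
exists q; split=> [k|a r ur ra]; last by apply: qG; exists r.
have : D (fun y => (y == k)%:R).
  by exists [:: k] => // y; rewrite inE => /negPf ->.
rewrite -ri => -[a _ ia]; exists a; apply: qG; exists [:: k] => /=.
  by split=> //= y; rewrite ia inE => /negPf ->.
by rewrite big_seq1 ia eqxx scale1r.
Qed.

(** What a direct summand of a direct sum of copies of [C] satisfies: on finitely many elements, the
    identity of [T] factors through a finite power of [C]. Conditions tested on finite families pass
    from [C] to [T]. *)
Definition locally_retract (C T : lmodType R) : Prop :=
  forall (J : finType) (x : J -> T),
  exists k (a : 'I_k -> {linear T -> C}) (b : 'I_k -> {linear C -> T}),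
    forall j, x j = \sum_l b l (a l (x j)).

(** A dual basis of [P]: the section [s] into the free module on the set [P] has coordinates which,
    tensored with [C], give the maps [a]; the maps [b] are c |-> p (x) c. *)
Lemma tensor_locally_retract (C T : lmodType R) : P_ C T -> locally_retract C T.
Proof.
move=> [P projP [t [[tC tP] tU]]].
have [A [i [iA AU]]] := free_module P.
have [q [qS qE]] := AU P id.
have [s sE] := projP A P q idfun qS.
(* [h p] sends t (x, c) to the coefficient of [s x] at [p] times c *)
have /choice[h hE] (p : P) : exists h : {linear T -> C},
    forall x c, h (t x c) = i (s x) p *: c.
  have [|h [hE _]] := tU C (fun x c => i (s x) p *: c); last by exists h.
  split=> [x|c] a u v.
    by rewrite scalerDr !scalerA mulrC.
  by rewrite !linearP [(_ + _) p]/(a * i (s u) p + i (s v) p) scalerDl scalerA.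
have /choice[tl tlE] (p : P) : exists f : {linear C -> T}, forall c, f c = t p c.
  exact: (@linear_map_exists R R C T *:%R (t p) (tC p)).
(* The elements recovered from finitely many nonzero coordinates. They form a submodule containing
   every [t x c], and uniqueness in the universal property makes it all of [T]. *)
pose Z : set T := [set z | exists2 r : seq P, uniq r /\
  supported_on r (fun p => h p z) & z = \sum_(p <- r) t p (h p z)].
have st r z : supported_on r (fun p => h p z) ->
    supported_on r (fun p => t p (h p z)).
  by move=> rz y /rz ->; rewrite -tlE linear0.
have sZ : submodule Z.
  split=> [|a b [r [ur ra] aE] [r' [ur' rb] bE]|c a [r [ur ra] aE]].
  - by exists [::]; rewrite ?big_nil //; split=> // y _; rewrite linear0.
  - have u := undup_uniq (r ++ r').
    exists (undup (r ++ r')); first split=> // y yr.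
      by rewrite linearD (supported_catl ra yr) (supported_catr rb yr); exact: addr0.
    rewrite {1}aE {1}bE.
    rewrite (supported_sum ur u (st _ _ ra) (st _ _ (supported_catl ra))).
    rewrite (supported_sum ur' u (st _ _ rb) (st _ _ (supported_catr rb))).
    by rewrite -big_split; apply: eq_bigr => y _ /=; rewrite linearD -!tlE linearD.
  - exists r.
      split=> // y yr.
      by rewrite linearZ [LHS]/(c *: h y a) (ra _ yr); exact: scaler0.
    rewrite {1}aE scaler_sumr; apply: eq_bigr => y _.
    by rewrite linearZ_LR -!tlE linearZ_LR.
have Zt x c : Z (t x c).
  have [r ur rs] := iA (s x).
  exists r; first by split=> // y yr; rewrite hE rs ?scale0r.
  have xE : x = \sum_(p <- r) i (s x) p *: p by rewrite -qE // sE.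
  have [f fE] : exists f : {linear P -> T}, forall y, f y = t y c.
    exact: (@linear_map_exists R R P T *:%R (t^~ c) (tP c)).
  rewrite -fE {1}xE linear_sum; apply: eq_bigr => p _.
  by rewrite linearZ_LR !fE hE -!tlE linearZ_LR.
have ZT z : Z z.
  have [B [k [kinj rk]]] := submodule_module sZ.
  have /choice[t' t'E] (u : P * C) : exists b, k b = t u.1 u.2.
    by have := Zt u.1 u.2; rewrite -rk => -[b _]; exists b.
  have [|h' [h'E _]] := tU B (fun x c => t' (x, c)).
    split=> [x|c] a u v; apply: kinj; rewrite linearP !t'E /=.
      by have := tC x a u v.
    by have := tP c a u v.
  have [|g [_ gU]] := tU T t; first by split.
  have -> : z = k (h' z).
    rewrite -[LHS](congr1 (fun f : {linear T -> T} => f z) (gU idfun _)) //.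
    by rewrite (gU (k \o h')) // => x c /=; rewrite h'E t'E.
  by rewrite -rk; exists (h' z).
move=> J x; have /choice[r rP] j : exists r : seq P, [/\ uniq r,
    supported_on r (fun p => h p (x j)) & x j = \sum_(p <- r) t p (h p (x j))].
  by have [r [? ?] ?] := ZT (x j); exists r.
pose R0 := undup (flatten [seq r j | j <- enum J]).
exists (size R0), (fun l => h (tnth (in_tuple R0) l)),
  (fun l => tl (tnth (in_tuple R0) l)) => j.
have [ur rj xE] := rP j.
have rj' : supported_on R0 (fun p => h p (x j)).
  move=> p pR; apply: rj; apply: contra pR; rewrite mem_undup => pr.
  by apply/flattenP; exists (r j) => //; apply: map_f; rewrite mem_enum.
rewrite {1}xE (supported_sum ur (undup_uniq _) (st _ _ rj) (st _ _ rj')).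
by rewrite [LHS](big_tnth _ _ R0); apply: eq_bigr => l _; rewrite tlE.
Qed.

End Approximation.

(** * Cohomology with coefficients in a resolved module *)

Section CohomologyOfResolutions.
Variables (R : comPzRingType) (F : matrix_resolution R).

(* H^(n+1)(Hom(F, W)) = 0 *)
Definition coh_zero (n : nat) (W : lmodType R) : Prop :=
  forall phi : {linear 'rV[R]_(rk F n.+1) -> W},
    (forall x, phi (x *m dmx F n.+1) = 0) ->
  exists psi : {linear 'rV[R]_(rk F n) -> W}, forall x, phi x = psi (x *m dmx F n).

Lemma coh_zero_injective n (W : lmodType R) : injective_module W -> coh_zero n W.
Proof.
move=> iW phi phi0.
have [|_ [x [/esym/mx_exact[y ->] ->]]//|psi psiE] := injective_extend
  (G := [set z : 'rV[R]_(rk F n) * W | exists x, z = (x *m dmx F n, phi x)]) iW.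
  split=> [|_ _ [x ->] [y ->]|a _ [x ->]]; first by exists 0; rewrite mul0mx linear0.
    by exists (x + y); rewrite mulmxDl linearD.
  by exists (a *: x); rewrite -scalemxAl linearZ_LR.
by exists psi => x; apply/esym/psiE; exists x.
Qed.

(** [phi] is determined by finitely many values, so it is the sum of the [b l \o a l \o phi], and
    each [a l \o phi] is a cocycle in [C]. *)
Lemma coh_zero_retract n (C T : lmodType R) :
  locally_retract C T -> coh_zero n C -> coh_zero n T.
Proof.
move=> CT Cn phi phi0.
have [k [a [b abE]]] := CT _ (fun i => phi (delta_mx 0 i)).
have /choice[psi psiE] l : exists psi : {linear 'rV[R]_(rk F n) -> C},
    forall x, a l (phi x) = psi (x *m dmx F n).
  by apply: (Cn (a l \o phi)) => x /=; rewrite phi0 linear0.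
have [|psi' psi'E] := @linear_map_exists R R _ T *:%R (fun x => \sum_l b l (psi l x)).
  move=> c x y; rewrite /= scaler_sumr -big_split; apply: eq_bigr => l _.
  by rewrite !linearP.
exists psi' => x; rewrite psi'E.
under eq_bigr do rewrite -psiE.
rewrite [in LHS]row_linearE [phi x]row_linearE /lincomb.
under [in RHS]eq_bigr do rewrite !linear_sum.
rewrite exchange_big; apply: eq_bigr => i _.
rewrite {1}abE scaler_sumr; apply: eq_bigr => l _.
by rewrite !linearZ_LR.
Qed.

Section Shift.
Variables (X : chain R) (N : nat).
Hypotheses (cohX : forall n j, coh_zero n (X j))
  (exX : forall n, (1 <= n)%N -> homology_zero X n)
  (X0 : forall n, (N < n)%N -> forall x : X n, x = 0).

(** Ext^(n+1)(-, B_j) = 0 for the boundaries B_j of [X j], by induction on the distance [k] to the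
    top of [X]. A lift [f] of [phi] to [X j.+1] fails to be a cocycle by a map into B_(j+1);
    induction corrects [f], and [cohX] applies to the result. *)
Lemma coh_boundary k j n (phi : {linear 'rV[R]_(rk F n.+1) -> X j}) :
  (N <= j + k)%N -> (forall x, phi (x *m dmx F n.+1) = 0) ->
  (forall x, is_boundary (phi x)) ->
  exists chi : {linear 'rV[R]_(rk F n) -> X j.+1},
    forall x, phi x = ch_d X j (chi (x *m dmx F n)).
Proof.
elim: k j n phi => [|k IHk] j n phi Nj phi0 phib.
  exists \0 => x; have [y <-] := phib x.
  by rewrite (X0 _ y) ?linear0 // ltnS -(addn0 j).
have [f fE] : exists f : {linear 'rV[R]_(rk F n.+1) -> X j.+1},
    forall x, ch_d X j (f x) = phi x.
  have /choice[v vE] i : exists y, ch_d X j y = phi (delta_mx 0 i) by apply: phib.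
  exists (lincomb v) => x; rewrite linear_lincomb [RHS]row_linearE.
  by congr lincomb; apply/funext.
have [|x|x|chi chiE] := IHk j.+1 n.+1 (f \o mulmxr (dmx F n.+1)).
- by rewrite addSnnS.
- by rewrite /= -mulmxA mx_mx mulmx0 linear0.
- by apply: exX => //=; rewrite fE phi0.
have [|psi psiE] := @cohX n j.+1 (f \- (ch_d X j.+1 \o chi)).
  by move=> x /=; have /= <- := chiE x; rewrite subrr.
exists psi => x; rewrite -psiE /= linearB ch_dd fE.
by rewrite subr0.
Qed.

Variables (C M : lmodType R) (eps : {linear 'rV[R]_(rk F 0) -> C}).
Hypotheses (epsS : forall c, exists x, eps x = c)
  (epsK : forall x, eps x = 0 <-> exists y, x = y *m dmx F 0).
Variable e : {linear X 0%N -> M}.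
Hypotheses (eS : forall m, exists x, e x = m)
  (eK : forall x, e x = 0 <-> is_boundary x).

(** The obstruction lies in Ext^1(C, ker [e]), and ker [e] is the module of boundaries in degree
    0. *)
Lemma lift_to_chain (phi : {linear C -> M}) :
  exists psi : {linear C -> X 0%N}, forall c, e (psi c) = phi c.
Proof.
have [f fE] := @projective_row R _ _ _ e (phi \o eps) eS.
have epsx x : eps (x *m dmx F 0) = 0 by apply/epsK; exists x.
have [|x|x|chi chiE] := @coh_boundary N 0 0 (f \o mulmxr (dmx F 0)).
- exact: leq_addl.
- by rewrite /= -mulmxA mx_mx mulmx0 linear0.
- by apply/eK; rewrite fE /= epsx linear0.
have [|x /epsK[y ->]|psi psiE] := @linear_factor R _ _ _ eps (f \- (ch_d X 0 \o chi)).
- exact: epsS.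
- by rewrite /= -chiE /= subrr.
exists psi => c; have [x <-] := epsS c; rewrite psiE /= linearB.
rewrite (_ : e (ch_d X 0 (chi x)) = 0) ?subr0 ?fE //.
by apply/eK; exists (chi x).
Qed.

End Shift.

End CohomologyOfResolutions.

(** * The two evaluations of C (x) Hom(C, M) *)

Section Swap.
Variable R : comPzRingType.

Lemma row_coefficients (V : lmodType R) m (v : 'I_m -> V) :
  (forall x, exists a : 'I_m -> R, x = \sum_(i < m) a i *: v i) ->
  forall x, exists y, lincomb v y = x.
Proof.
move=> gv x; have [a ->] := gv x; exists (\row_i a i).
by apply: eq_bigr => i _; rewrite mxE.
Qed.

Lemma semidualizing_coh_zero (C : lmodType R) (F : matrix_resolution R)
    (eps : {linear 'rV[R]_(rk F 0) -> C}) n :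
  semidualizing C ->
  (forall c, exists x, eps x = c) ->
  (forall x, eps x = 0 <-> exists y, x = y *m dmx F 0) ->
  coh_zero F n C.
Proof.
move=> [_ _ extC] eS eK phi phi0.
have [|y yE] := extC n.+1 isT _ (fg_projective_resolution eS eK) (phi : lin_hom _ _).
  by apply: lin_hom_ext => x; apply: phi0.
by exists y => x; rewrite -yE.
Qed.

Lemma semidualizing_endo (C : lmodType R) (h : {linear C -> C}) :
  semidualizing C -> exists r, forall x, h x = r *: x.
Proof.
case=> _ [g _ gK] _; exists (g h) => x.
by rewrite -[h in LHS](gK h).
Qed.

Lemma semidualizing_faithful (C : lmodType R) (r : R) :
  semidualizing C -> (forall x : C, r *: x = 0) -> r = 0.
Proof.
case=> _ /bij_inj inj _ r0; apply: inj; apply: lin_hom_ext => x /=.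
by rewrite scale0r r0.
Qed.

Variables (C M I : lmodType R) (mu : {linear M -> lin_hom C I}) (X : chain R)
  (e : {linear X 0%N -> M}).
Hypotheses (sdC : semidualizing C) (CX : forall n, locally_retract C (X n))
  (eK : forall x, e x = 0 <-> is_boundary x)
  (lift : forall phi : {linear C -> M},
    exists psi : {linear C -> X 0%N}, forall c, e (psi c) = phi c).

(* The evaluation map from C (x) Hom(C, M) to M is injective, so that the
   second evaluation c (x) phi |-> mu (phi -) c factors through the first. *)
Lemma evaluation_swap (phi : {linear C -> M}) c :
  phi c = 0 -> forall x, mu (phi x) c = 0.
Proof.
move=> phic x.
have [m [g gC]] : finitely_generated C by case: sdC.
have [f fE] := lift phi.
have [y yE] : is_boundary (f c) by apply/eK; rewrite fE.
have [k [a [b abE]]] := CX (fun _ : unit => y).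
(* [None] is the lift of [phi], [Some l] a map killed by [e]. On generators of [C] all factor
   through the same [b' q]; as endomorphisms of [C] are homotheties, they become combinations of the
   [b' q] with scalars [r]. *)
pose fam (l : option 'I_k) : {linear C -> X 0%N} :=
  if l is Some l then ch_d X 0 \o b l else f.
have [k' [a' [b' abE']]] := CX (fun u : option 'I_k * 'I_m => fam u.1 (g u.2)).
have famE l z : fam l z = \sum_q b' q (a' q (fam l z)).
  have [w ->] := gC z; rewrite linear_sum.
  under [RHS]eq_bigr do rewrite !linear_sum.
  rewrite exchange_big; apply: eq_bigr => i _.
  rewrite linearZ_LR {1}(abE' (l, i)) scaler_sumr.
  by apply: eq_bigr => q _; rewrite !linearZ_LR.
have /choice[r rE] (u : 'I_k' * option 'I_k) : exists r, forall z,
    a' u.1 (fam u.2 z) = r *: z.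
  exact: (semidualizing_endo (a' u.1 \o fam u.2)).
have famR l z : fam l z = \sum_q r (q, l) *: b' q z.
  by rewrite famE; apply: eq_bigr => q _; rewrite (rE (q, l)) linearZ_LR.
(* Both sides are [a' q (f c)], computed once directly and once with [f c] as the boundary of
   [y]. *)
have cE q : r (q, None) *: c = \sum_l r (q, Some l) *: a l y.
  rewrite -(rE (q, None)) /= -yE {1}(abE tt) !linear_sum.
  by apply: eq_bigr => l _; rewrite -(rE (q, Some l)).
have muE z (w : 'I_k' -> R) : mu (e (\sum_q w q *: b' q x)) z =
    \sum_q mu (e (b' q x)) (w q *: z).
  rewrite !linear_sum.
  have -> (h : 'I_k' -> lin_hom C I) : (\sum_q h q) z = \sum_q h q z.
    by elim/big_rec2: _ => // q u v _ <-.
  by apply: eq_bigr => q _; rewrite !linearZ_LR.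
(* The scalars move through [mu] onto [c], are exchanged by [cE], and move back; only values of [e]
   on boundaries remain. *)
rewrite -fE -[f x]/(fam None x) famR muE.
under eq_bigr do rewrite cE linear_sum.
rewrite exchange_big big1 // => l _; rewrite -muE -famR /=.
have -> : e (ch_d X 0 (b l x)) = 0 by apply/eK; exists (b l x).
by rewrite linear0.
Qed.

End Swap.

(** * Localization at a prime *)

Lemma ideal_generators (R : comPzRingType) (J : set R) :
  noetherian R -> is_ideal J ->
  exists m (g : 'I_m -> R), (forall i, J (g i)) /\
  forall r, J r -> exists a : 'I_m -> R, r = \sum_(i < m) a i * g i.
Proof.
move=> noethR /noethR[m [g JE]]; exists m, g; split=> [i|r].
  rewrite JE; exists (fun j => (j == i)%:R) => //.
  rewrite (bigD1 i) //= eqxx mul1r big1 ?addr0 // => j ji.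
  by rewrite (negPf ji) mul0r.
by rewrite JE => -[a _ <-]; exists a.
Qed.

Section Localization.
Variables (R : comPzRingType) (p : set R) (S : comPzRingType)
  (f : {rmorphism R -> S}).
Hypotheses (primep : prime_ideal p) (locR : is_localization p f).

Lemma prime0 : p 0. Proof. by case: primep => -[]. Qed.
Lemma prime1 : ~ p 1. Proof. by case: primep. Qed.
Lemma prime_compM s t : ~ p s -> ~ p t -> ~ p (s * t).
Proof. by case: primep => _ _ pM ps pt /pM[]. Qed.
Lemma primeD x y : p x -> p y -> p (x + y).
Proof. by case: primep => -[_ + _] _ _; apply. Qed.
Lemma primeM a x : p x -> p (a * x).
Proof. by case: primep => -[_ _ +] _ _; apply. Qed.

Lemma loc_inv s : ~ p s -> exists u, u * f s = 1.
Proof. by case: locR => + _ _; apply. Qed.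

Lemma loc_frac z : exists r s, ~ p s /\ z * f s = f r.
Proof.
case: locR => _ /(_ z)[r [s [u [ps us ->]]]] _; exists r, s; split=> //.
by rewrite mulrAC us mul1r.
Qed.

Lemma loc_eq x y : f x = f y -> exists2 s, ~ p s & s * x = s * y.
Proof. by case: locR => _ _; apply. Qed.

Lemma loc_fracs (J : finType) (z : J -> S) :
  exists (r : J -> R) s, ~ p s /\ forall j, z j * f s = f (r j).
Proof.
have [|j|s ps sP] := @common_multiplier R p J (fun j s => exists r, z j * f s = f r) primep.
- by move=> j a s [r zr]; exists (a * r); rewrite !rmorphM -zr mulrCA.
- by have [r [s [ps zs]]] := loc_frac (z j); exists s => //; exists r.
by have /choice[r rP] := sP; exists r, s.
Qed.

Lemma loc_cancel (N : lmodType S) s (x y : N) :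
  ~ p s -> f s *: x = f s *: y -> x = y.
Proof.
move=> /loc_inv[u us] xy.
by rewrite -[x]scale1r -us -scalerA xy scalerA us scale1r.
Qed.

Definition loc_max : set S := [set z | exists r s, [/\ p r, ~ p s & z * f s = f r]].

Lemma loc_max_f r : p r -> loc_max (f r).
Proof. by move=> pr; exists r, 1; rewrite rmorph1 mulr1; split=> //; apply: prime1. Qed.

Lemma loc_max_ideal : is_ideal loc_max.
Proof.
split=> [|x y [r [s [pr ps xE]]] [r' [s' [pr' ps' yE]]]|a x [r [s [pr ps xE]]]].
- by exists 0, 1; rewrite mul0r rmorph0; split=> //; [apply: prime0|apply: prime1].
- exists (s' * r + s * r'), (s * s'); split; last 2 first.
  + exact: prime_compM.
  + by rewrite rmorphD !rmorphM -xE -yE; ring.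
  + by apply: primeD; apply: primeM.
- have [r' [s' [ps' aE]]] := loc_frac a.
  exists (r' * r), (s' * s); split; [exact: primeM|exact: prime_compM|].
  by rewrite !rmorphM -aE -xE mulrACA.
Qed.

Lemma loc_max1 : ~ loc_max 1.
Proof.
move=> [r [s [pr ps]]]; rewrite mul1r => /loc_eq[t pt tE].
by apply: (prime_compM pt ps); rewrite tE; apply: primeM.
Qed.

Lemma loc_max_unit z : ~ loc_max z -> exists v, v * z = 1.
Proof.
have [r [s [ps zE]]] := loc_frac z => zm.
have [|v vr] := @loc_inv r; first by move=> pr; apply: zm; exists r, s.
by exists (v * f s); rewrite -vr -zE -mulrA [z * _]mulrC.
Qed.

Lemma proper_sub_loc_max (J : set S) : is_ideal J -> ~ J 1 -> J `<=` loc_max.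
Proof.
move=> [_ _ JM] J1 z Jz; apply: contrapT => /loc_max_unit[v vz].
by apply: J1; rewrite -vz; apply: JM.
Qed.

Lemma maximal_loc_max : maximal_ideal loc_max.
Proof.
split; [exact: loc_max_ideal|exact: loc_max1|move=> J iJ J1 mJ].
by apply/seteqP; split=> //; apply: proper_sub_loc_max.
Qed.

Lemma maximal_idealE m : maximal_ideal m -> m = loc_max.
Proof.
move=> [im m1 mP]; apply/esym/mP; [exact: loc_max_ideal|exact: loc_max1|].
exact: proper_sub_loc_max.
Qed.

Lemma loc_local : local_ring S.
Proof. by exists loc_max; split=> [|m /maximal_idealE]; [exact: maximal_loc_max|]. Qed.

Lemma contract_ideal (J : set S) : is_ideal J -> is_ideal (f @^-1` J).
Proof.
case=> J0 JD JM; split=> [|x y Jx Jy|a x Jx]; rewrite /= ?rmorph0 //.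
  by rewrite rmorphD; apply: JD.
by rewrite rmorphM; apply: JM.
Qed.

Hypothesis noethR : noetherian R.

Lemma contract_gen (J : set S) : is_ideal J ->
  exists m (g : 'I_m -> R), (forall i, J (f (g i))) /\
  forall r, J (f r) -> exists a : 'I_m -> R, r = \sum_(i < m) a i * g i.
Proof.
by move=> /contract_ideal iJ; apply: (ideal_generators noethR iJ).
Qed.

Lemma loc_noetherian : noetherian S.
Proof.
move=> J iJ; have [m [g [Jg gJ]]] := contract_gen iJ.
have [J0 JD JM] := iJ.
exists m, (fun i => f (g i)); apply/seteqP; split=> [z Jz|_ [a _ <-]]; last first.
  by apply: (big_ind J) => // i _; apply: JM.
have [r [s [ps zE]]] := loc_frac z.
have [|a aE] := gJ r; first by rewrite -zE mulrC; apply: JM.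
have [u us] := loc_inv ps.
exists (fun i => u * f (a i)) => //.
rewrite -[z]mul1r -us -mulrA [f s * z]mulrC zE aE rmorph_sum mulr_sumr.
by apply: eq_bigr => i _; rewrite rmorphM mulrA.
Qed.

Section ScalarExtension.
Variable Q : lmodType R.
Hypotheses (Qinj : forall s (x : Q), ~ p s -> s *: x = 0 -> x = 0)
  (Qsurj : forall s (x : Q), ~ p s -> exists y, s *: y = x).

Lemma scalar_cancel s (x y : Q) : ~ p s -> s *: x = s *: y -> x = y.
Proof.
move=> ps xy; apply/eqP; rewrite -subr_eq0; apply/eqP/(Qinj ps).
by rewrite scalerBr xy subrr.
Qed.

(** [E] has the carrier of [Q]: r/s times q is the unique y with s y = r q, which does not depend on
    the fraction chosen. *)
Lemma scalar_extension : exists (E : lmodType S)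
  (pi : {linear Q -> E | f \; *:%R}), bijective pi.
Proof.
have /choice[sc scP] (zq : S * Q) : exists y, forall r s, ~ p s ->
    zq.1 * f s = f r -> s *: y = r *: zq.2.
  have [r0 [s0 [ps0 z0]]] := loc_frac zq.1.
  have [y yE] := Qsurj (r0 *: zq.2) ps0; exists y => r s ps zs.
  have /loc_eq[t pt tE] : f (r0 * s) = f (r * s0) by rewrite !rmorphM -z0 -zs mulrAC.
  apply: (scalar_cancel (prime_compM pt ps0)).
  rewrite !scalerA [t * s0 * r]mulrAC -[t * r * s0]mulrA -tE.
  by rewrite [t * s0 * s]mulrAC -[LHS]scalerA yE scalerA mulrAC mulrA.
have {}scP z q r s : ~ p s -> z * f s = f r -> s *: sc (z, q) = r *: q.
  exact: (scP (z, q)).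
have scA a b q : sc (a, sc (b, q)) = sc (a * b, q).
  have [r1 [s1 [ps1 aE]]] := loc_frac a; have [r2 [s2 [ps2 bE]]] := loc_frac b.
  have ps := prime_compM ps2 ps1; apply: (scalar_cancel ps).
  rewrite -scalerA (scP _ _ _ _ ps1 aE) (scP _ _ (r1 * r2) _ ps); last first.
    by rewrite !rmorphM -aE -bE [f s2 * _]mulrC mulrACA.
  by rewrite scalerA [s2 * r1]mulrC -!scalerA (scP _ _ _ _ ps2 bE).
have scE r q : sc (f r, q) = r *: q.
  by rewrite -(scP (f r) q r 1) ?scale1r ?rmorph1 ?mulr1 //; apply: prime1.
have sc1 q : sc (1, q) = q by rewrite -(rmorph1 f) scE scale1r.
have scDr a : {morph (fun q => sc (a, q)) : x y / x + y}.
  move=> x y; have [r [s [ps aE]]] := loc_frac a; apply: (scalar_cancel ps).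
  by rewrite scalerDr !(scP _ _ _ _ ps aE) scalerDr.
have scDl q : {morph (fun a => sc (a, q)) : x y / x + y}.
  move=> x y; have [r [s [ps xE]]] := loc_fracs (fun b : bool => if b then x else y).
  have xE' := xE true; have yE := xE false; apply: (scalar_cancel ps).
  rewrite scalerDr (scP _ _ _ _ ps xE') (scP _ _ _ _ ps yE) -scalerDl.
  by apply: scP; rewrite // mulrDl rmorphD xE' yE.
pose E : lmodType S := HB.pack (Algebra.Zmodule.sort Q)
  (GRing.Zmodule_isLmodule.Build S Q (scale := fun a q => sc (a, q)) scA sc1 scDr scDl).
have [|pi piE] := @linear_map_exists R S Q E (f \; *:%R) (fun q => q).
  by move=> a x y; congr (_ + _); apply/esym/scE.
exists E, pi; exists (fun q : E => q : Q) => x; exact: piE.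
Qed.

End ScalarExtension.

End Localization.

(** * Localization of injective modules *)

Lemma lincomb_mulmx (R : comPzRingType) (V : lmodType R) m n (v : 'I_n -> V)
    (A : 'M[R]_(m, n)) x :
  lincomb v (x *m A) = lincomb (fun l => lincomb v (row l A)) x.
Proof. by rewrite mulmx_sum_row linear_sum; apply: eq_bigr => l _; rewrite linearZ_LR. Qed.

Lemma lincombZ (R : comPzRingType) (V : lmodType R) n (v : 'I_n -> V) a x :
  lincomb (fun i => a *: v i) x = a *: lincomb v x.
Proof.
by rewrite scaler_sumr; apply: eq_bigr => i _; rewrite !scalerA mulrC.
Qed.

Section ExtByCoresolution.
Variable S : comPzRingType.

(** Only the values of [f] need be hit by [g]: the pullback of [g] along [f] maps onto [P], hence
    splits. *)
Lemma projective_lift (P A B : lmodType S) (g : {linear A -> B}) (f : {linear P -> B}) :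
  projective_module P -> (forall x, exists a, g a = f x) ->
  exists h : {linear P -> A}, forall x, g (h x) = f x.
Proof.
move=> pP gf; pose G : set (P * A) := [set z | g z.2 = f z.1].
have [|D [i [_ iG]]] := @submodule_module S _ G.
  split=> [|[x a] [y b] /= xa yb|c [x a] /= xa]; rewrite /G /=.
  - by rewrite !linear0.
  - by rewrite !linearD xa yb.
  - by rewrite !linearZ_LR xa.
have [x|h hE] := pP D P (fst \o i) idfun.
  have [a ga] := gf x.
  have : G (x, a) by [].
  by rewrite -iG => -[d _ dE]; exists d; rewrite /= dE.
exists (snd \o i \o h) => x /=.
have : G (i (h x)) by rewrite -iG; exists (h x).
by rewrite /G /= => ->; congr (f _); apply: hE.
Qed.

Variables (k N : lmodType S) (Y : nat -> lmodType S)
  (del : forall j, {linear Y j -> Y j.+1}) (kap : {linear N -> Y 0%N}).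
Hypotheses (injY : forall j, injective_module (Y j))
  (exY : forall j y, del j.+1 y = 0 -> exists x, del j x = y)
  (dd : forall j y, del j.+1 (del j y) = 0)
  (kY : forall j (h : {linear k -> Y j}) x, h x = 0)
  (kapI : injective kap)
  (kapE : forall y, del 0 y = 0 <-> exists x, kap x = y).

Lemma Ext_zero_coresolution n : Ext_zero n k N.
Proof.
move=> P [projP [eps [epsS epsK]] exP].
(* In the double complex Hom([P m], [Y j]), each step lowers m and raises j by one; at m = 0 the map
   factors through [k] and vanishes by [kY]. On the way back, exactness of [Y] corrects [psi] into a
   cocycle. *)
have main m j (phi : {linear P m -> Y j}) :
    (forall x, phi (ch_d P m x) = 0) -> (forall x, del j (phi x) = 0) ->
    match m return {linear P m -> Y j} -> Prop with
    | 0 => fun phi => forall x, phi x = 0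
    | m'.+1 => fun phi => exists psi : {linear P m' -> Y j},
        (forall x, del j (psi x) = 0) /\ (forall x, phi x = psi (ch_d P m' x))
    end phi.
  elim: m j phi => [|m IHm] j phi phid dphi.
    move=> x; have [|a /epsK[y <-]//|h hE] := @linear_factor S _ _ _ eps phi.
      exact: epsS.
    by rewrite -hE kY.
  have [||psi psiE] := @injective_extend S _ _
    [set z | exists x, z = (ch_d P m x, phi x)] (@injY j).
  - split=> [|_ _ [x ->] [y ->]|a _ [x ->]]; first by exists 0; rewrite !linear0.
      by exists (x + y); rewrite !linearD.
    by exists (a *: x); rewrite !linearZ_LR.
  - by move=> _ [x [/esym dx ->]]; have [y <-] := @exP m.+1 isT x dx.
  have psid x : phi x = psi (ch_d P m x) by apply/esym/psiE; exists x.
  have dpsi x : del j (psi (ch_d P m x)) = 0 by rewrite -psid.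
  have := IHm j.+1 (del j \o psi) dpsi (fun x => dd (psi x)).
  case: m IHm phi phid dphi psi psiE psid dpsi => [|m] IHm phi phid dphi psi psiE psid dpsi.
    by move=> psi0; exists psi.
  move=> [chi [dchi chiE]].
  have [x|chi' chi'E] := @projective_lift _ _ _ (del j) chi (@projP m).
    exact: exY.
  exists (psi \- (chi' \o ch_d P m)); split=> x /=.
    by rewrite linearB /= chi'E -chiE /= subrr.
  by rewrite ch_dd linear0 subr0.
move=> phi phi0; have phid x : phi (ch_d P n x) = 0.
  by have := congr1 (fun h : lin_hom _ _ => h x) phi0.
have kphi x : del 0 (kap (phi x)) = 0 by apply/kapE; exists (phi x).
have := main n 0%N (kap \o phi).
case: n phi phi0 phid kphi => [|n] phi phi0 phid kphi /=.
  move=> h; apply: lin_hom_ext => x /=; apply: kapI; rewrite linear0.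
  by apply: h => // y; rewrite phid linear0.
case=> [x||psi [dpsi psiE]]; rewrite ?phid ?linear0 //.
have [|||psi' psi'E] := @functional_linear S _ _ [set z | kap z.2 = psi z.1].
- split=> [|[x a] [y b] /= xa yb|c [x a] /= xa]; rewrite /= ?linear0 //.
    by rewrite !linearD xa yb.
  by rewrite !linearZ_LR xa.
- by move=> y /=; rewrite linear0 -(linear0 kap) => /kapI.
- by move=> x; have /kapE := dpsi x.
exists psi'; apply: lin_hom_ext => x /=; apply: psi'E => /=.
by rewrite -psiE.
Qed.

End ExtByCoresolution.

Section LocalizedInjective.
Variables (R : comPzRingType) (p : set R) (S : comPzRingType)
  (f : {rmorphism R -> S}).
Hypotheses (primep : prime_ideal p) (locR : is_localization p f)
  (noethR : noetherian R).

Lemma torsion_bound :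
  exists2 t, ~ p t & forall r s, ~ p s -> s * r = 0 -> t * r = 0.
Proof.
have [|m [g [gK gE]]] := @ideal_generators R
    [set r | exists2 s, ~ p s & s * r = 0] noethR.
  split=> [|x y [s ps sx] [t pt ty]|a x [s ps sx]].
  - by exists 1; rewrite ?mulr0 //; apply: (prime1 primep).
  - exists (s * t); first exact: (prime_compM primep).
    by rewrite mulrDr mulrAC sx mul0r -mulrA ty mulr0 addr0.
  - by exists s => //; rewrite mulrCA sx mulr0.
have [|i|t pt tg] := @common_multiplier R p 'I_m (fun i s => s * g i = 0) primep.
- by move=> i a s sg; rewrite -mulrA sg mulr0.
- exact: gK.
exists t => // r s ps sr; have [|a ->] := gE r; first by exists s.
by rewrite mulr_sumr big1 // => i _; rewrite mulrCA tg mulr0.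
Qed.

Lemma common_annihilator (V : lmodType R) (J : finType) (v : J -> V) :
  (forall j, exists2 s, ~ p s & s *: v j = 0) ->
  exists2 s, ~ p s & forall j, s *: v j = 0.
Proof.
apply: (@common_multiplier R p J (fun j s => s *: v j = 0) primep) => j a s sv.
by rewrite -scalerA sv scaler0.
Qed.

Variable I : lmodType R.
Hypothesis injI : injective_module I.

(** Elements outside [p] act bijectively on [I] modulo torsion, so this quotient already is the
    localization. *)
Lemma localized_injective : exists (E : lmodType S) (pi : {linear I -> E | f \; *:%R}),
  [/\ forall y, exists x, pi x = y,
      forall x, pi x = 0 <-> exists2 s, ~ p s & s *: x = 0 &
      injective_module E].
Proof.
pose K : set I := [set x | exists2 s, ~ p s & s *: x = 0].
have [|Q [pi0 [pi0S pi0K]]] := @quotient_module R I K.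
  split=> [|x y [s ps sx] [t pt ty]|a x [s ps sx]].
  - by exists 1; rewrite ?scaler0 //; apply: (prime1 primep).
  - exists (s * t); first exact: (prime_compM primep).
    by rewrite scalerDr mulrC -scalerA sx mulrC -scalerA ty !scaler0 addr0.
  - by exists s => //; rewrite scalerA mulrC -scalerA sx scaler0.
have [||E [pi1 [pi1' piK piK']]] := @scalar_extension R p S f primep locR Q.
- move=> s q ps; have [x <-] := pi0S q.
  rewrite -linearZ_LR => /pi0K[t pt tx]; apply/pi0K.
  by exists (t * s); [exact: (prime_compM primep)|rewrite -scalerA].
- move=> s q ps; have [x <-] := pi0S q; have [t pt tP] := torsion_bound.
  (* Sending [s] to [x] need not be well defined; sending [t * s] to [t *: x] is, since [t] kills
     whatever some element outside [p] kills. *)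
  have [||h hE] := @injective_extend R R^o I
    [set z | exists r, z = (r * (t * s), r *: (t *: x))] injI.
  + split=> [|_ _ [r ->] [r' ->]|a _ [r ->]].
    * by exists 0; rewrite mul0r scale0r.
    * by exists (r + r'); rewrite mulrDl scalerDl.
    * by exists (a * r); rewrite -mulrA -scalerA.
  + move=> _ [r [/esym rts ->]]; rewrite scalerA [r * t]mulrC (tP r (t * s)) ?scale0r //.
      exact: (prime_compM primep).
    by rewrite mulrC.
  have hts : t *: (s *: h 1) = t *: x.
    rewrite scalerA -linearZ_LR; apply: hE; exists 1.
    by rewrite mul1r scale1r [_ *: _]mulr1.
  exists (pi0 (h 1)); apply/eqP; rewrite -subr_eq0 -linearZ_LR -linearB; apply/eqP/pi0K.
  by exists t => //; rewrite scalerBr hts subrr.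
have [|pi piE] := @linear_map_exists R S I E (f \; *:%R) (pi1 \o pi0).
  by move=> a x y /=; rewrite !linearP.
exists E, pi; have piS y : exists x, pi x = y.
  by have [x xE] := pi0S (pi1' y); exists x; rewrite piE /= xE piK'.
have pi_ker x : pi x = 0 <-> exists2 s, ~ p s & s *: x = 0.
  rewrite piE /=; split=> [|/pi0K ->]; last by rewrite linear0.
  by rewrite -(linear0 pi1) => /(can_inj piK)/pi0K.
split=> //; apply: baer_injective => G sG fG.
have piZ a x : pi (a *: x) = f a *: pi x by rewrite linearZ.
pose J : set S := [set z | exists y, G (z, y)].
have [G0 GD GZ] := sG.
have [|m [g [Jg gJ]]] := @contract_gen R S f noethR J.
  split=> [|x y [x' Gx] [y' Gy]|a x [x' Gx]]; first by exists 0.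
    by exists (x' + y'); apply: (GD _ _ Gx Gy).
  by exists (a *: x'); apply: (GZ a _ Gx).
have /choice[y yP] i : exists y, G (f (g i), pi y).
  by have [y Gy] := Jg i; have [x xE] := piS y; exists x; rewrite xE.
have Glin (x : 'rV[R]_m) : G (f (lincomb (g : _ -> R^o) x), pi (lincomb y x)).
  rewrite /lincomb rmorph_sum linear_sum.
  have -> : (\sum_i f (x 0 i *: (g i : R^o)), \sum_i pi (x 0 i *: y i)) =
      \sum_i f (x 0 i) *: ((f (g i), pi (y i)) : (S^o * E)%type).
    rewrite [RHS]surjective_pairing (raddf_sum fst) (raddf_sum snd) /=.
    congr pair; apply: eq_bigr => i _; last exact: piZ.
    by rewrite [_ *: _]/(x 0 i * g i) rmorphM.
  by apply: submodule_sum => // i; apply: (GZ _ _ (yP i)).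
(* Relations among the [g i] hold for the preimages [y i] only up to torsion. As finitely many
   relations generate all, one [s] makes the [s *: y i] satisfy them; [s] is inverted at the end. *)
have [|k [A AP]] := @submodule_row_fg R noethR m
    [set x | lincomb (g : _ -> R^o) x = 0].
  split=> [|x x' /= x0 x0'|a x /= x0]; rewrite /= ?linear0 //.
    by rewrite linearD /= x0 x0' addr0.
  by rewrite linearZ_LR /= x0; exact: scaler0.
have [|s ps sA] := @common_annihilator I 'I_k (fun l => lincomb y (row l A)).
  move=> l; apply/pi_ker/fG; rewrite -(rmorph0 f).
  have <- : lincomb (g : _ -> R^o) (row l A) = 0; last exact: Glin.
  by apply/AP; exists (delta_mx 0 l); rewrite rowE.
have [||h hE] := @injective_extend R R^o I
    [set z | exists x, z = (lincomb (g : _ -> R^o) x, s *: lincomb y x)] injI.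
- split=> [|_ _ [x ->] [x' ->]|a _ [x ->]].
  + by exists 0; rewrite !linear0.
  + by exists (x + x'); rewrite !linearD.
  + exists (a *: x); rewrite [lincomb y (_ *: _)]linearZ_LR [lincomb _ (_ *: _)]linearZ_LR.
    by congr pair; rewrite /= !scalerA mulrC.
- move=> _ [x [/esym/AP[w ->] ->]].
  rewrite lincomb_mulmx -lincombZ /lincomb big1 // => l _.
  by rewrite sA scaler0.
have hw x : s *: lincomb y x = lincomb (g : _ -> R^o) x *: h 1.
  rewrite -[RHS]linearZ_LR; apply/esym/hE; exists x; congr pair.
  exact: mulr1.
have [u us] := loc_inv locR ps.
exists (u *: pi (h 1)) => z v Gzv.
have [r [s' [ps' zE]]] := loc_frac locR z.
have Gr : G (f r, f s' *: v) by rewrite -zE mulrC; apply: (GZ (f s') _ Gzv).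
have [|a aE] := gJ r; first by exists (f s' *: v).
have rE : r = lincomb (g : _ -> R^o) (\row_i a i).
  by rewrite aE; apply: eq_bigr => i _; rewrite mxE.
have vE := functional_relE sG fG Gr; rewrite rE in vE.
have {}vE := vE _ (Glin _).
apply: (loc_cancel locR ps'); rewrite vE; apply: (loc_cancel locR ps).
rewrite -piZ hw -rE piZ !scalerA; congr (_ *: _).
by rewrite -zE -[LHS]mul1r -us; ring.
Qed.

End LocalizedInjective.

(** * Depth and associated primes *)

Lemma injective_row_hom (S : comPzRingType) n (E : lmodType S) :
  injective_module E -> injective_module (lin_hom 'rV[S]_n E).
Proof.
move=> iE A B g h ginj.
have [|h' h'E] := @linear_map_exists S S A ('I_n -> E) *:%R
    (fun a i => h a (delta_mx 0 i)).
  by move=> c x y; apply/funext => i; rewrite linearP.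
have [H HE] := injective_fun iE h' ginj.
have [|K KE] := @linear_map_exists S S B (lin_hom 'rV[S]_n E) *:%R
    (fun b => lincomb (H b) : lin_hom _ _).
  move=> c x y; apply: lin_hom_ext => z /=.
  rewrite /lincomb scaler_sumr -big_split; apply: eq_bigr => i _.
  by rewrite linearP [(_ + _) i]/(c *: H x i + H y i) scalerDr !scalerA mulrC.
exists K => x; rewrite KE; apply: lin_hom_ext => z /=.
rewrite [RHS]row_linearE; congr (lincomb _ z); apply/funext => i.
by rewrite HE h'E.
Qed.

Section LocalizedResolution.
Variables (R : comPzRingType) (p : set R) (S : comPzRingType)
  (f : {rmorphism R -> S}).
Hypotheses (primep : prime_ideal p) (locR : is_localization p f).

Lemma row_frac n (x : 'rV[S]_n) :
  exists y s, ~ p s /\ f s *: x = map_mx f y.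
Proof.
have [r [s [ps rE]]] := loc_fracs primep locR (fun j => x 0 j).
exists (\row_j r j), s; split=> //; apply/rowP => j.
by rewrite !mxE mulrC rE.
Qed.

Lemma row_torsion n (x : 'rV[R]_n) :
  map_mx f x = 0 -> exists2 s, ~ p s & s *: x = 0.
Proof.
move=> fx; have [j|s ps sx] := @common_annihilator R p primep R^o 'I_n (fun j => x 0 j).
  have : f (x 0 j) = f 0 by have := congr1 (fun y : 'rV[S]_n => y 0 j) fx; rewrite !mxE rmorph0.
  by move=> /(loc_eq locR)[s ps]; rewrite mulr0; exists s.
by exists s => //; apply/rowP => j; rewrite !mxE; apply: sx.
Qed.

Variable F : matrix_resolution R.

Fact loc_exact n (x : 'rV[S]_(rk F n.+1)) :
  x *m map_mx f (dmx F n) = 0 <-> exists y, x = y *m map_mx f (dmx F n.+1).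
Proof.
split=> [xA|[y ->]]; last by rewrite -mulmxA -map_mxM mx_mx map_mx0 mulmx0.
have [y [s [ps yE]]] := row_frac x.
have [|t pt tyA] := @row_torsion _ (y *m dmx F n).
  by rewrite map_mxM -yE -scalemxAl xA scaler0.
have /mx_exact[z zE] : (t *: y) *m dmx F n = 0 by rewrite -scalemxAl.
have [u us] := loc_inv locR ps; have [v vt] := loc_inv locR pt.
exists ((u * v) *: map_mx f z); rewrite -scalemxAl -map_mxM -zE map_mxZ -yE.
rewrite !scalerA (_ : _ * _ = (u * f s) * (v * f t)); last by ring.
by rewrite us vt mul1r scale1r.
Qed.

Definition loc_resolution : matrix_resolution S :=
  @MatrixResolution S (rk F) (fun n => map_mx f (dmx F n)) loc_exact.

End LocalizedResolution.

Section DepthDetectsAssociatedPrime.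
Variables (R : comPzRingType) (p : set R) (S : comPzRingType)
  (f : {rmorphism R -> S}).
Hypotheses (primep : prime_ideal p) (locR : is_localization p f)
  (noethR : noetherian R).

Lemma localized_module_extend (M : lmodType R) (Mp N : lmodType S)
    (g : {linear M -> Mp | f \; *:%R}) (kap : {linear M -> N | f \; *:%R}) :
  is_localized_module p g ->
  exists kap' : {linear Mp -> N}, forall m, kap' (g m) = kap m.
Proof.
move=> [gfrac gker].
have gZ a x : g (a *: x) = f a *: g x by rewrite linearZ.
have kZ a x : kap (a *: x) = f a *: kap x by rewrite linearZ.
pose G : set (Mp * N) := [set z | exists m s,
  [/\ ~ p s, f s *: z.1 = g m & f s *: z.2 = kap m]].
have sg s (z : Mp) (y : N) m : G (z, y) -> ~ p s -> f s *: z = g m -> f s *: y = kap m.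
  move=> [m' [s' /= [ps' zE yE]]] ps zE'.
  have /gker[t pt tE] : g (s' *: m) = g (s *: m').
    by rewrite !gZ -zE -zE' !scalerA mulrC.
  have := congr1 kap tE; rewrite !kZ -yE => /(loc_cancel locR pt).
  rewrite scalerA [f s * _]mulrC -scalerA => /(loc_cancel locR ps') -> //.
have G0 : G (0, 0).
  by exists 0, 1; split; rewrite ?linear0 ?scaler0 //; apply: (prime1 primep).
have [|y Gy|z|h hE] := @functional_linear S Mp N G.
- split=> // [[x a] [y b] [m [s /= [ps xE aE]]] [m' [s' /= [ps' yE bE]]]|c [x a] [m [s /= [ps xE aE]]]].
    exists (s' *: m + s *: m'), (s * s'); split; first exact: (prime_compM primep).
      by rewrite [g (_ + _)]linearD !gZ /= -xE -yE scalerDr !scalerA rmorphM [f s' * _]mulrC.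
    by rewrite [kap (_ + _)]linearD !kZ /= -aE -bE scalerDr !scalerA rmorphM [f s' * _]mulrC.
  have [r [t [pt cE]]] := loc_frac locR c.
  exists (r *: m), (t * s); split; first exact: (prime_compM primep).
    by rewrite gZ /= -xE !scalerA rmorphM -cE mulrAC [f t * c]mulrC.
  by rewrite kZ /= -aE !scalerA rmorphM -cE mulrAC [f t * c]mulrC.
- have := sg 1 _ _ 0 Gy (prime1 primep); rewrite !linear0 rmorph1 scale1r; exact.
- have [m [s [u [ps us zE]]]] := gfrac z; exists (u *: kap m), m, s.
  by split; rewrite //= ?zE scalerA mulrC us scale1r.
exists h => m; apply: hE; exists m, 1.
by split; rewrite /= ?rmorph1 ?scale1r //; apply: (prime1 primep).
Qed.

Variables (C M I : lmodType R) (mu : {linear M -> lin_hom C I})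
  (Mp : lmodType S) (g : {linear M -> Mp | f \; *:%R}).
Hypotheses (injI : injective_module I) (fgC : finitely_generated C)
  (mu_bij : bijective mu) (locM : is_localized_module p g).

Lemma Ext_zero_localized n (k : lmodType S) :
  (forall e : I, ~ forall r, r *: e = 0 <-> p r) ->
  residue_field k -> Ext_zero n k Mp.
Proof.
move=> noass [m /(maximal_idealE primep locR) -> [q [qS qK]]].
have [c [v gC]] := fgC.
have [F [eps [epsR epsK]]] := fg_resolution noethR v.
have epsS x : exists y, eps y = x.
  have [y yE] := row_coefficients gC x.
  have : range eps x by rewrite epsR; exists y.
  by case=> y' _; exists y'.
have [E [pi [piS piK injE]]] := localized_injective primep locR noethR injI.
have piZ a x : pi (a *: x) = f a *: pi x by rewrite linearZ.
(* Hom([FS], [E]) is the coresolution by powers of [E]; in degree 0 its cohomology is Hom(C, I)_p,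
   that is [Mp]. *)
pose FS := loc_resolution primep locR F.
pose Y j : lmodType S := lin_hom 'rV[S]_(rk FS j) E.
pose del j : {linear Y j -> Y j.+1} := lin_hom_pre (mulmxr (dmx FS j)).
(* kap0 m sends f(z)/1 to the class of mu m (eps z) *)
have pi_lincomb n' (w : 'I_n' -> I) z :
    pi (lincomb w z) = lincomb (fun i => pi (w i)) (map_mx f z).
  by rewrite linear_sum; apply: eq_bigr => i _; rewrite piZ mxE.
have [|kap0 kap0E] := @linear_map_exists R S M (Y 0%N) (f \; *:%R)
    (fun m => lincomb (fun i => pi (mu m (eps (delta_mx 0 i)))) : lin_hom _ _).
  move=> a x y; apply: lin_hom_ext => z /=.
  rewrite /lincomb scaler_sumr -big_split; apply: eq_bigr => i _ /=.
  by rewrite linearD linearZ_LR /= linearD piZ scalerDr !scalerA mulrC.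
have kap0f x z : kap0 x (map_mx f z) = pi (mu x (eps z)).
  rewrite kap0E /= -pi_lincomb [in RHS]row_linearE.
  by rewrite (linear_lincomb (mu x)).
have [kap kapE] := localized_module_extend kap0 locM.
have [gfrac gker] := locM.
have row_delta N (h : {linear 'rV[S]_N -> E}) : (forall z, h (map_mx f z) = 0) ->
    forall x, h x = 0.
  move=> h0 x; have [y [s [ps yE]]] := row_frac primep locR x.
  by apply: (loc_cancel locR ps); rewrite -linearZ_LR yE h0 scaler0.
apply: (@Ext_zero_coresolution S k Mp Y del kap).
- by move=> j; apply: injective_row_hom.
- move=> j y y0; have [x|psi psiE] := @coh_zero_injective S FS j E injE y.
    by have := congr1 (fun h : lin_hom _ _ => h x) y0.
  by exists psi; apply: lin_hom_ext => x; apply/esym/psiE.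
- move=> j y; apply: lin_hom_ext => x /=.
  by rewrite -mulmxA -map_mxM mx_mx map_mx0 mulmx0 linear0.
(* A value of [h] is killed by the maximal ideal, so its preimage [w], times some [s] outside [p],
   is killed by [p]. Since no annihilator equals [p], [w] is torsion. *)
- move=> j h x; apply: lin_hom_ext; apply: row_delta => z.
  have hr r : p r -> f r *: h x (map_mx f z) = 0.
    move=> pr; have [a <-] := qS x.
    have -> : f r *: h (q a) (map_mx f z) = h (f r *: q a) (map_mx f z).
      by rewrite linearZ_LR.
    rewrite -linearZ_LR; have -> : q (f r *: a) = 0; last by rewrite linear0.
    apply/qK; have [_ _ mM] := loc_max_ideal primep locR.
    by rewrite [_ *: _]mulrC; apply: mM; apply: loc_max_f.
  have [w wE] := piS (h x (map_mx f z)).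
  have [m' [gp [pg gpE]]] : exists m (gp : 'I_m -> R), (forall i, p (gp i)) /\
      forall r, p r -> exists a : 'I_m -> R, r = \sum_(i < m) a i * gp i.
    by apply: ideal_generators => //; case: primep.
  have [i|s ps sg] := @common_annihilator R p primep I 'I_m' (fun i => gp i *: w).
    by apply/piK; rewrite piZ wE hr.
  have ps0 r : p r -> r *: (s *: w) = 0.
    move=> /gpE[a ->]; rewrite scaler_suml big1 // => i _.
    by rewrite -scalerA [gp i *: _]scalerA mulrC -scalerA sg scaler0.
  rewrite -wE; apply/piK; apply: contrapT => nw; apply: (noass (s *: w)) => r.
  split=> [rs|/ps0//]; apply: contrapT => pr; apply: nw.
  by exists (r * s); [exact: (prime_compM primep)|rewrite -scalerA].
- suff kapK z : kap z = 0 -> z = 0.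
    move=> x y /eqP; rewrite -subr_eq0 -linearB => /eqP/kapK/eqP.
    by rewrite subr_eq0 => /eqP.
  move=> kz; have [x [s [u [ps us zE]]]] := gfrac z.
  have k0 : kap0 x = 0.
    rewrite -kapE; move: kz; rewrite zE linearZ_LR => /(congr1 ( *:%R (f s))).
    by rewrite scalerA mulrC us scale1r scaler0.
  have [j|t pt tE] := @common_annihilator R p primep I 'I_(rk F 0)
      (fun j => mu x (eps (delta_mx 0 j))).
    by apply/piK; rewrite -kap0f k0.
  have tx : t *: x = 0.
    apply: (bij_inj mu_bij); rewrite linear0 linearZ_LR; apply: lin_hom_ext => y.
    have [y' <-] := epsS y; rewrite /= [eps y']row_linearE (linear_lincomb (mu x)).
    rewrite -lincombZ /lincomb big1 // => j _ /=.
    by rewrite tE scaler0.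
  rewrite zE (_ : g x = 0) ?scaler0 //; apply: (loc_cancel locR pt).
  by rewrite scaler0 -(linear0 g) -tx linearZ.
- move=> y; split=> [y0|[z <-]]; last first.
    have [x [s [u [ps us ->]]]] := gfrac z.
    rewrite !linearZ_LR kapE; suff -> : del 0 (kap0 x) = 0 by rewrite scaler0.
    apply: lin_hom_ext; apply: row_delta => z' /=.
    rewrite -map_mxM kap0f; have -> : eps (z' *m dmx F 0) = 0; last by rewrite !linear0.
    by apply/epsK; exists z'.
  (* Preimages of a cocycle respect the relations of [C] up to torsion; a common multiplier [s]
     turns them into a map [theta] from [C] to [I], hence an element of [M]. *)
  have /choice[w wE] j : exists w, pi w = y (delta_mx 0 j) by apply: piS.
  have yE z : y (map_mx f z) = pi (lincomb w z).
    rewrite pi_lincomb [LHS]row_linearE; congr (lincomb _ _).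
    by apply/funext.
  have [l|s ps sA] := @common_annihilator R p primep I _ (fun l => lincomb w (row l (dmx F 0))).
    apply/piK; rewrite -yE rowE map_mxM.
    by have := congr1 (fun h : lin_hom _ _ => h (map_mx f (delta_mx 0 l))) y0.
  have [|z /epsK[z' ->]|theta thetaE] := @linear_factor R _ _ _ eps (s \*: lincomb w).
  - exact: epsS.
  - by rewrite /= lincomb_mulmx -lincombZ /lincomb big1 // => l _; rewrite sA scaler0.
  have [mu' _ muK] := mu_bij.
  have [u us] := loc_inv locR ps.
  exists (u *: g (mu' theta)); rewrite linearZ_LR kapE.
  suff -> : kap0 (mu' theta) = f s *: y by rewrite scalerA us scale1r.
  apply: lin_hom_ext => x; apply/eqP; rewrite -subr_eq0; apply/eqP.
  apply: (row_delta _ (kap0 (mu' theta) \- (f s *: y : lin_hom _ _))) => z /=.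
  by rewrite kap0f muK thetaE /= piZ yE subrr.
Qed.

End DepthDetectsAssociatedPrime.

(** * The semidualizing module is locally cyclic *)

Section LocallyCyclic.
Variables (R : comPzRingType) (p : set R) (C I : lmodType R) (e : I).
Hypotheses (primep : prime_ideal p) (fgC : finitely_generated C)
  (faithfulC : forall r, (forall x : C, r *: x = 0) -> r = 0)
  (eP : forall r, r *: e = 0 <-> p r)
  (swapC : forall (b : {linear C -> lin_hom C I}) c,
     b c = 0 -> forall x, b x c = 0).

Definition loc_generators n (c : 'I_n -> C) t : Prop :=
  ~ p t /\ forall x, exists w, t *: x = lincomb c w.

(** Subtracting [w 0 i] times the relation from [v 0 i] times the expression of [t *: x] eliminates
    [c i]. *)
Lemma loc_generators_lift n (c : 'I_n.+1 -> C) t i (v : 'rV[R]_n.+1) :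
  loc_generators c t -> lincomb c v = 0 -> ~ p (v 0 i) ->
  exists (c' : 'I_n -> C) t', loc_generators c' t'.
Proof.
move=> [pt ct] v0 pv; exists (c \o lift i), (v 0 i * t).
split=> [|x]; first exact: (prime_compM primep).
have [w wE] := ct x.
exists (\row_j (v 0 i * w 0 (lift i j) - w 0 i * v 0 (lift i j))).
have z : w 0 i *: lincomb c v = 0 by rewrite v0 scaler0.
rewrite -scalerA wE -[LHS]subr0 -z.
rewrite /lincomb !scaler_sumr -sumrB (bigD1_ord i) //= !scalerA [w 0 i * _]mulrC.
rewrite subrr add0r; apply: eq_bigr => j _.
by rewrite mxE !scalerA -scalerBl.
Qed.

Lemma loc_cyclic : exists c t, ~ p t /\ forall x : C, exists r, t *: x = r *: c.
Proof.
pose P n := `[< exists (c : 'I_n -> C) t, loc_generators c t >].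
have exP : exists n, P n.
  have [n [c cE]] := fgC; exists n; apply/asboolP; exists c, 1.
  split=> [|x]; first exact: (prime1 primep).
  by have [w wE] := row_coefficients cE x; exists w; rewrite scale1r.
case: (ex_minnP exP) => -[|[|n]] /asboolP[c [t [pt ct]]] minP.
- exfalso; apply: pt; rewrite (faithfulC (r := t)); first exact: (prime0 primep).
  by move=> x; have [w ->] := ct x; rewrite /lincomb big_ord0.
- exists (c 0), t; split=> // x; have [w ->] := ct x.
  by exists (w 0 0); rewrite /lincomb big_ord1.
exfalso; have v0p v i : lincomb c v = 0 -> p (v 0 i).
  move=> v0; apply: contrapT => pv.
  have /asboolP/minP : exists (c' : 'I_n.+1 -> C) t', loc_generators c' t'.
    exact: (loc_generators_lift (conj pt ct) v0 pv).
  by rewrite ltnn.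
(* By minimality, coefficients of relations lie in [p], so coordinates become well defined once
   multiplied by [e]. *)
have vwp v w i : lincomb c v = lincomb c w -> v 0 i *: e = w 0 i *: e.
  move=> vw; apply/eqP; rewrite -subr_eq0 -scalerBl; apply/eqP/eP.
  have -> : v 0 i - w 0 i = (v - w) 0 i by rewrite !mxE.
  by apply: v0p; rewrite linearB /= vw subrr.
have /choice[w wE] := ct.
have wL i a x y : w (a *: x + y) 0 i *: e = (a * w x 0 i + w y 0 i) *: e.
  have -> : a * w x 0 i + w y 0 i = (a *: w x + w y) 0 i by rewrite !mxE.
  apply: vwp; rewrite -wE [RHS]linearP /= -!wE.
  by rewrite scalerDr !scalerA mulrC.
have wc i j : w (c i) 0 j *: e = (t *+ (i == j)) *: e.
  have -> : t *+ (i == j) = (t *: delta_mx 0 i : 'rV_n.+2) 0 j.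
    by rewrite !mxE eqxx /= eq_sym mulr_natr.
  by apply: vwp; rewrite -wE [RHS]linearZ_LR /= lincomb_delta.
have /choice[bx bxE] x : exists bx : {linear C -> I}, forall y,
    bx y = (w x 0 0 * w y 0 1) *: e.
  apply: (@linear_map_exists R R C I *:%R) => a y y' /=.
  by rewrite -[LHS]scalerA wL !scalerA -scalerDl; congr (_ *: _); ring.
have [|b bE] := @linear_map_exists R R C (lin_hom C I) *:%R (fun x => bx x : lin_hom _ _).
  move=> a x x'; apply: lin_hom_ext => y /=; rewrite !bxE.
  by rewrite mulrC -[LHS]scalerA wL !scalerA -scalerDl; congr (_ *: _); ring.
have b1 : b (c 1) = 0.
  apply: lin_hom_ext => y; rewrite bE bxE /= mulrC -scalerA wc /=.
  by rewrite mulr0n scale0r scaler0.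
(* [b] vanishes on ([c 1], -), yet its value at ([c 0], [c 1]) is [(t * t) *: e], which is nonzero.
   The factors [t] are there because [w] holds the coordinates of [t *: x]. *)
have := swapC b1 (c 0); rewrite bE bxE -scalerA wc /= mulr1n scalerA mulrC -scalerA wc.
by rewrite eqxx mulr1n scalerA => /eP; apply: (prime_compM primep).
Qed.

End LocallyCyclic.

(** * Local vanishing of Tor and Ext *)

Section MatrixTensor.
Variable R : comPzRingType.

(* A (x) V, for the row vector convention R^m -> R^n. *)
Definition mxact (V : lmodType R) m n (A : 'M[R]_(m, n)) (v : 'I_m -> V) j : V :=
  \sum_i A i j *: v i.

Lemma mxact_lincomb (V : lmodType R) m n (A : 'M[R]_(m, n)) (v : 'I_m -> V) j :
  mxact A v j = lincomb v (row j A^T).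
Proof. by apply: eq_bigr => i _; rewrite !mxE. Qed.

Lemma linear_mxact (V W : lmodType R) (h : {linear V -> W}) m n (A : 'M[R]_(m, n))
    (v : 'I_m -> V) j :
  h (mxact A v j) = mxact A (fun i => h (v i)) j.
Proof. by rewrite linear_sum; apply: eq_bigr => i _; rewrite linearZ_LR. Qed.

Lemma mxactZ (V : lmodType R) m n (A : 'M[R]_(m, n)) a (v : 'I_m -> V) j :
  mxact A (fun i => a *: v i) j = a *: mxact A v j.
Proof. by rewrite !mxact_lincomb lincombZ. Qed.

Lemma mxactB (V : lmodType R) m n (A : 'M[R]_(m, n)) (v w : 'I_m -> V) j :
  mxact A (fun i => v i - w i) j = mxact A v j - mxact A w j.
Proof. by rewrite /mxact -sumrB; apply: eq_bigr => i _; rewrite scalerBr. Qed.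

Lemma mxactM (V : lmodType R) m n k (A : 'M[R]_(m, n)) (B : 'M[R]_(n, k))
    (v : 'I_m -> V) j :
  mxact B (mxact A v) j = mxact (A *m B) v j.
Proof.
rewrite /mxact; under eq_bigr do rewrite scaler_sumr.
rewrite exchange_big; apply: eq_bigr => i _; rewrite mxE scaler_suml.
by apply: eq_bigr => l _; rewrite scalerA mulrC.
Qed.

Lemma mxact_row (m n : nat) (A : 'M[R]_(m, n)) (x : 'rV[R]_m) (V : lmodType R) (c : V) j :
  (x *m A) 0 j *: c = mxact A (fun i => x 0 i *: c) j.
Proof.
rewrite mxE scaler_suml; apply: eq_bigr => i _.
by rewrite scalerA mulrC.
Qed.

End MatrixTensor.

Section LocalExactness.
Variables (R : comPzRingType) (p : set R) (F : matrix_resolution R).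
Hypothesis primep : prime_ideal p.

(* Tor_(n+1)(-, V)_p = 0 for the module resolved by F *)
Definition tor_zero n (V : lmodType R) : Prop :=
  forall v : 'I_(rk F n.+1) -> V, (forall j, mxact (dmx F n) v j = 0) ->
  exists s w, ~ p s /\ forall i, s *: v i = mxact (dmx F n.+1) w i.

Lemma mxact_dmx (V : lmodType R) n (v : 'I_(rk F n.+2) -> V) j :
  mxact (dmx F n) (mxact (dmx F n.+1) v) j = 0.
Proof.
by rewrite mxactM mx_mx; apply: big1 => i _; rewrite mxE scale0r.
Qed.

(** C_p is R_p through [c]: coordinates with respect to [c] turn a cycle of F (x) C into a cycle of
    F, up to powers of [t]. *)
Lemma tor_zero_cyclic n (C : lmodType R) c t :
  (forall r, (forall x : C, r *: x = 0) -> r = 0) ->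
  ~ p t -> (forall x : C, exists r, t *: x = r *: c) -> tor_zero n C.
Proof.
move=> faithfulC pt /choice[r rE] v v0.
have ann_c a : a *: c = 0 -> t * a = 0.
  move=> ac; apply: faithfulC => x.
  by rewrite mulrC -scalerA rE scalerA mulrC -scalerA ac scaler0.
pose x : 'rV[R]_(rk F n.+1) := \row_i r (v i).
have xv i : x 0 i *: c = t *: v i by rewrite mxE rE.
have /mx_exact[y yE] : (t *: x) *m dmx F n = 0.
  apply/rowP => j; rewrite -scalemxAl !mxE -[LHS]/(t * _); apply: ann_c.
  have := mxact_row (dmx F n) x c j; rewrite mxE => ->.
  by rewrite /mxact; under eq_bigr do rewrite xv; rewrite [LHS]mxactZ v0 scaler0.
exists (t * t), (fun l => y 0 l *: c); split; first exact: (prime_compM primep).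
by move=> i; rewrite -mxact_row -yE mxE -!scalerA xv.
Qed.

Lemma tor_zero_retract n (C T : lmodType R) :
  locally_retract C T -> tor_zero n C -> tor_zero n T.
Proof.
move=> CT torC v v0; have [k [a [b abE]]] := CT _ v.
have [l r s|l|s ps /choice[w wE]] := @common_multiplier R p 'I_k (fun l s =>
    exists w, forall i, s *: a l (v i) = mxact (dmx F n.+1) w i) primep.
- move=> [w wE]; exists (fun i => r *: w i) => i.
  by rewrite mxactZ -wE scalerA.
- have [j|s [w [ps wE]]] := torC (fun i => a l (v i)).
    by rewrite -linear_mxact v0 linear0.
  by exists s => //; exists w.
exists s, (fun i => \sum_l b l (w l i)); split=> // i.
rewrite {1}abE scaler_sumr.
under eq_bigr do rewrite -linearZ_LR wE linear_mxact.
rewrite exchange_big; apply: eq_bigr => j _.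
by rewrite scaler_sumr.
Qed.

(** The piece Tor_(n+2)(T) -> Tor_(n+2)(im g) -> Tor_(n+1)(ker g) of the long exact sequence,
    localized at [p]. *)
Lemma tor_zero_step n (T V : lmodType R) (g : {linear T -> V}) :
  (forall v : 'I_(rk F n.+1) -> T, (forall i, g (v i) = 0) ->
    (forall j, mxact (dmx F n) v j = 0) ->
    exists s w, [/\ ~ p s, forall i, g (w i) = 0 &
      forall i, s *: v i = mxact (dmx F n.+1) w i]) ->
  tor_zero n.+1 T ->
  forall v : 'I_(rk F n.+2) -> V, (forall i, exists x, g x = v i) ->
    (forall j, mxact (dmx F n.+1) v j = 0) ->
    exists s w, ~ p s /\ forall i, s *: v i = g (mxact (dmx F n.+2) w i).
Proof.
move=> torZ torT v /choice[v' v'E] v0.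
have gv j : g (mxact (dmx F n.+1) v' j) = 0.
  rewrite linear_mxact -[RHS](v0 j); congr (mxact _ _ j).
  exact/funext.
have [s [w [ps gw wE]]] := torZ _ gv (mxact_dmx v').
have [j|s' [y [ps' yE]]] := torT (fun i => s *: v' i - w i).
  by rewrite mxactB mxactZ wE subrr.
exists (s' * s), y; split; first exact: (prime_compM primep).
by move=> i; rewrite -yE linearZ_LR linearB linearZ_LR /= v'E gw subr0 scalerA.
Qed.

Section Shift.
Variables (X : chain R) (N : nat).
Hypotheses (torX : forall n j, tor_zero n (X j))
  (exX : forall n, (1 <= n)%N -> homology_zero X n)
  (X0 : forall n, (N < n)%N -> forall x : X n, x = 0).

(** Tor_(n+1)(B_j)_p = 0 for the boundaries B_j of [X j]. Each step up in [X] costs one degree of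
    Tor, whence the condition on [k] and [n]; at [k] = 0 the boundaries vanish. *)
Lemma tor_zero_boundary k j n (v : 'I_(rk F n.+1) -> X j) :
  (N <= j + k)%N -> (k <= n)%N -> (forall i, is_boundary (v i)) ->
  (forall i, mxact (dmx F n) v i = 0) ->
  exists s w, ~ p s /\ forall i, s *: v i = ch_d X j (mxact (dmx F n.+1) w i).
Proof.
elim: k j n v => [|k IHk] j n v Nj kn vb v0.
  exists 1, (fun=> 0); split=> [|i]; first exact: (prime1 primep).
  have X1 (y : X j.+1) : y = 0 by apply: X0; rewrite ltnS -(addn0 j).
  have [y <-] := vb i; rewrite [y]X1 [mxact _ _ _ in RHS]X1.
  by rewrite linear0 scaler0.
case: n kn v vb v0 => // n kn v vb v0.
apply: (tor_zero_step _ _ vb v0) => // u du u0.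
have [||i|i|s [w [ps wE]]] := IHk j.+1 n u; rewrite ?addSnnS //.
  by apply: exX => //=.
exists s, (fun i => ch_d X j.+1 (w i)); split=> // i; first exact: ch_dd.
by rewrite wE linear_mxact.
Qed.

Lemma tor_zero_resolved (M : lmodType R) (e : {linear X 0%N -> M}) n :
  (forall m, exists x, e x = m) -> (forall x, e x = 0 <-> is_boundary x) ->
  (N <= n)%N -> tor_zero n.+1 M.
Proof.
move=> eS eK Nn v v0.
have [|i|//|s [w [ps wE]]] := tor_zero_step (n := n) (g := e) (v := v) _ (@torX n.+1 0%N).
- move=> u eu u0; have [||i|//|s [w [ps wE]]] := @tor_zero_boundary N 0 n u; rewrite ?add0n //.
    exact/eK.
  exists s, (fun i => ch_d X 0 (w i)); split=> // i; last by rewrite wE linear_mxact.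
  by apply/eK; exists (w i).
- exact: eS.
exists s, (fun i => e (w i)); split=> // i.
by rewrite wE linear_mxact.
Qed.

End Shift.

(** Evaluation at [c] identifies M_p = Hom(C, I)_p with I_p, its kernel and the obstruction to
    lifting being killed by [t]. *)
Lemma tor_zero_hom n (C M I : lmodType R) (mu : {linear M -> lin_hom C I}) c t :
  injective_module I -> bijective mu ->
  (forall r, (forall x : C, r *: x = 0) -> r = 0) ->
  ~ p t -> (forall x : C, exists r, t *: x = r *: c) ->
  tor_zero n M -> tor_zero n I.
Proof.
move=> injI [mu' muK mu'K] faithfulC pt ct torM v v0.
have ann_c a : a *: c = 0 -> a * t = 0.
  move=> ac; apply: faithfulC => x; have [r rE] := ct x.
  by rewrite -scalerA rE scalerA mulrC -scalerA ac scaler0.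
have /choice[phi phiE] i : exists m, mu m c = t *: v i.
  have [||h hE] := @injective_extend R C I
    [set z | exists r, z = (r *: c, (r * t) *: v i)] injI.
  - split=> [|_ _ [r ->] [r' ->]|a _ [r ->]].
    + by exists 0; rewrite mul0r !scale0r.
    + by exists (r + r'); rewrite mulrDl !scalerDl.
    + by exists (a * r); congr pair; rewrite /= !scalerA ?mulrA.
  - by move=> _ [r [/esym/ann_c rt ->]]; rewrite rt scale0r.
  by exists (mu' h); rewrite mu'K; apply: hE; exists 1; rewrite mul1r scale1r.
have t0 m : mu m c = 0 -> t *: m = 0.
  move=> mc; apply: (can_inj muK); rewrite linear0 linearZ_LR.
  apply: lin_hom_ext => x /=; have [r rE] := ct x.
  by rewrite -linearZ_LR rE linearZ_LR mc scaler0.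
have ev j k (h : 'I_k -> M) (A : 'M[R]_(k, j)) i : mu (mxact A h i) c = mxact A (fun l => mu (h l) c) i.
  rewrite linear_mxact /mxact.
  have -> (J : finType) (G : J -> lin_hom C I) : (\sum_l G l) c = \sum_l G l c.
    by elim/big_rec2: _ => // l u w _ <-.
  by [].
have [j|s [w [ps wE]]] := torM (fun i => t *: phi i).
  rewrite mxactZ; apply: t0; rewrite ev.
  rewrite -[RHS](scaler0 _ t) -(v0 j) -mxactZ; congr (mxact _ _ j).
  exact/funext.
(* One [t] comes from lifting [v] through the evaluation, the other from making the lift a cycle. *)
exists (s * t * t), (fun l => mu (w l) c); split.
  by do 2![apply: (prime_compM primep) => //].
by move=> i; rewrite -ev -wE [mu (s *: _)]linearZ_LR [mu (t *: _)]linearZ_LR /= phiE !scalerA.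
Qed.

(* If the class of z in Ext were not locally zero at p, injectivity of I would
   extend z |-> e, and then e would be killed by some s outside p. *)
Lemma local_coboundary n (I : lmodType R) (e : I) :
  injective_module I -> (forall r, r *: e = 0 <-> p r) -> tor_zero n I ->
  forall z : 'cV[R]_(rk F n.+1), dmx F n.+1 *m z = 0 ->
  exists s y, ~ p s /\ s *: z = dmx F n *m y.
Proof.
move=> injI eP torI z z0; apply: contrapT => nz.
have pz a y : dmx F n *m y + a *: z = 0 -> p a.
  move=> /eqP; rewrite addrC addr_eq0 => /eqP az; apply: contrapT => pa.
  by apply: nz; exists a, (- y); rewrite mulmxN.
have [||h hE] := @injective_extend R 'cV[R]_(rk F n.+1) I
  [set u | exists y a, u = (dmx F n *m y + a *: z, a *: e)] injI.
- split=> [|_ _ [y [a ->]] [y' [a' ->]]|b _ [y [a ->]]].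
  + by exists 0, 0; rewrite mulmx0 !scale0r addr0.
  + by exists (y + y'), (a + a'); rewrite mulmxDr !scalerDl addrACA.
  + exists (b *: y), (b * a); rewrite -scalemxAr -!scalerA -scalerDr.
    by congr pair.
- by move=> _ [y [a [/esym/pz/eP ? ->]]].
have hd y : h (dmx F n *m y) = 0.
  by apply: hE; exists y, 0; rewrite !scale0r addr0.
have hz : h z = e by apply: hE; exists 0, 1; rewrite mulmx0 !scale1r add0r.
pose v i := h (delta_mx i 0).
have hE' u : h u = \sum_i u i 0 *: v i.
  rewrite {1}[u]matrix_sum_delta linear_sum; apply: eq_bigr => i _.
  by rewrite big_ord1 linearZ_LR.
(* [v] is a cycle since [h] kills the image of [dmx F n]. With [s *: v] the boundary of [w], the
   element [s *: h z] is the pairing of [dmx F n.+1 *m z] = 0 with [w]. *)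
have [j|s [w [ps wE]]] := torI v.
  rewrite -[RHS](hd (delta_mx j 0)) -colE hE'.
  by apply: eq_bigr => i _; rewrite mxE.
apply: ps; apply/eP; rewrite -hz -linearZ_LR hE'.
transitivity (\sum_i z i 0 *: mxact (dmx F n.+1) w i).
  by apply: eq_bigr => i _; rewrite -wE !mxE scalerA mulrC.
under eq_bigr do rewrite scaler_sumr.
rewrite exchange_big big1 // => l _.
under eq_bigr do rewrite scalerA mulrC.
rewrite -scaler_suml; have := congr1 (fun A : 'cV[R]_(rk F n.+2) => A l 0) z0.
by rewrite !mxE => ->; rewrite scale0r.
Qed.

End LocalExactness.

Section LocalizedCohomology.
Variables (R : comPzRingType) (p : set R) (S : comPzRingType)
  (f : {rmorphism R -> S}).
Hypotheses (primep : prime_ideal p) (locR : is_localization p f).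
Variable F : matrix_resolution R.

(** Hom out of finite free modules commutes with localization: [s] clears the denominators of a
    cocycle, and [t] the torsion left in its coboundary. *)
Lemma coh_zero_localized n :
  (forall z : 'cV[R]_(rk F n.+1), dmx F n.+1 *m z = 0 ->
    exists s y, ~ p s /\ s *: z = dmx F n *m y) ->
  coh_zero (loc_resolution primep locR F) n (S^o : lmodType S).
Proof.
move=> cobF phi phi0.
pose y : 'cV[S]_(rk F n.+1) := \col_i phi (delta_mx 0 i).
have phiE x : phi x = (x *m y) 0 0.
  by rewrite row_linearE mxE; apply: eq_bigr => i _; rewrite mxE.
have [r [s [ps rE]]] := loc_fracs primep locR (fun i => y i 0).
pose z : 'cV[R]_(rk F n.+1) := \col_i r i.
have zE : map_mx f z = f s *: y.
  by apply/colP => i; rewrite !mxE -rE mxE mulrC.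
have [i|t pt tz] := @common_annihilator R p primep R^o _ (fun i => (dmx F n.+1 *m z) i 0).
  have : f ((dmx F n.+1 *m z) i 0) = f 0.
    have -> : f ((dmx F n.+1 *m z) i 0) = (map_mx f (dmx F n.+1 *m z)) i 0 by rewrite [RHS]mxE.
    rewrite map_mxM zE -scalemxAr rmorph0 mxE.
    have -> : (map_mx f (dmx F n.+1) *m y) i 0 = 0; last by rewrite mulr0.
    by rewrite -[RHS](phi0 (delta_mx 0 i)) phiE -mulmxA -rowE [RHS]mxE.
  by move=> /(loc_eq locR)[t pt]; rewrite mulr0; exists t.
have [|s' [y' [ps' y'E]]] := cobF (t *: z).
  by rewrite -scalemxAr; apply/colP => i; rewrite !mxE; have := tz i; rewrite mxE.
have [u us] := loc_inv locR (prime_compM primep ps' (prime_compM primep pt ps)).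
have [|psi psiE] := @linear_map_exists S S _ S^o *:%R
    (fun x : 'rV[S]_(rk F n) => u * (x *m map_mx f y') 0 0).
  move=> a x x' /=; rewrite mulmxDl -scalemxAl !mxE mulrDr.
  by congr (_ + _); rewrite mulrCA.
exists psi => x; rewrite psiE phiE -mulmxA -map_mxM -y'E !map_mxZ zE.
rewrite !scalerA -scalemxAr [X in _ = u * X]mxE mulrA.
by rewrite -!rmorphM -[s' * t * s]mulrA us mul1r.
Qed.

End LocalizedCohomology.

(** * Injective coresolutions over the localization *)

Section InjectiveCoresolution.
Variables (S : comPzRingType) (E : lmodType S).
Hypotheses (injE : injective_module E)
  (cogE : forall (A : lmodType S) (a : A), a != 0 -> exists h : {linear A -> E}, h a != 0).

Record embedding (W : lmodType S) := Embedding {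
  emb_mod : lmodType S;
  emb_coker : lmodType S;
  emb_in : {linear W -> emb_mod};
  emb_pi : {linear emb_mod -> emb_coker} }.

(* Injective modules are embedded in themselves, so that the coresolution built
   below stops at the first injective cosyzygy. *)
Lemma embedding_exists (W : lmodType S) : exists x : embedding W,
  [/\ injective_module (emb_mod x), injective (emb_in x),
      (forall q, exists y, emb_pi x y = q) /\
      (forall y, emb_pi x y = 0 <-> exists w, emb_in x w = y),
      injective_module W -> forall q : emb_coker x, q = 0 &
      (forall w : W, w = 0) -> forall y : emb_mod x, y = 0].
Proof.
case: (pselect (injective_module W)) => injW.
  exists (@Embedding W W 'rV[S]_0 idfun \0); split=> //=; last first.
    by move=> _ q; apply/rowP => -[].
  split=> [q|y]; first by exists 0; apply/rowP => -[].
  by split=> // _; exists y.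
(* Evaluation into the power of [E] indexed by Hom(W, E); it is injective because [E] is a
   cogenerator. *)
have [|i iE] := @linear_map_exists S S W (lin_hom W E -> E) *:%R (fun w h => h w).
  by move=> a x y; apply/funext => h /=; rewrite linearP.
have [|Q [q [qS qK]]] := @quotient_module S _ (range i).
  split=> [|_ _ [x _ <-] [y _ <-]|a _ [x _ <-]].
  - by exists 0; rewrite ?linear0.
  - by exists (x + y); rewrite ?linearD.
  - by exists (a *: x); rewrite ?linearZ_LR.
exists (@Embedding W _ Q i q); split=> //=.
- exact: injective_fun.
- move=> x y /eqP; rewrite -subr_eq0 -linearB => /eqP ixy.
  apply/eqP; rewrite -subr_eq0; apply: contraT => /cogE[h].
  have := congr1 (fun g => g (h : lin_hom _ _)) ixy; rewrite iE => ->.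
  by rewrite eqxx.
- split=> // y; rewrite qK; split=> -[w]; first by exists w.
  by exists w.
- by move=> W0; case: injW; apply: injective_trivial.
Qed.

Definition emb (W : lmodType S) : embedding W := sval (cid (embedding_exists W)).

Lemma emb_injective (W : lmodType S) : injective_module (emb_mod (emb W)).
Proof. by case: (svalP (cid (embedding_exists W))). Qed.

Lemma emb_in_inj (W : lmodType S) : injective (emb_in (emb W)).
Proof. by case: (svalP (cid (embedding_exists W))). Qed.

Lemma emb_pi_surj (W : lmodType S) q : exists y, emb_pi (emb W) y = q.
Proof. by case: (svalP (cid (embedding_exists W))) => _ _ [+ _] _ _; apply. Qed.

Lemma emb_pi_ker (W : lmodType S) y :
  emb_pi (emb W) y = 0 <-> exists w, emb_in (emb W) w = y.
Proof. by case: (svalP (cid (embedding_exists W))) => _ _ [_ +] _ _; apply. Qed.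

Lemma emb_coker_trivial (W : lmodType S) :
  injective_module W -> forall q : emb_coker (emb W), q = 0.
Proof. by case: (svalP (cid (embedding_exists W))). Qed.

Lemma emb_mod_trivial (W : lmodType S) :
  (forall w : W, w = 0) -> forall y : emb_mod (emb W), y = 0.
Proof. by case: (svalP (cid (embedding_exists W))). Qed.

Lemma emb_pi_in (W : lmodType S) w : emb_pi (emb W) (emb_in (emb W) w) = 0.
Proof. by apply/emb_pi_ker; exists w. Qed.

Lemma emb_in_eq0 (W : lmodType S) w : emb_in (emb W) w = 0 -> w = 0.
Proof. by rewrite -(linear0 (emb_in (emb W))) => /emb_in_inj. Qed.

Definition cosyzygy n : lmodType S :=
  iter n (fun W => emb_coker (emb W)) (S^o : lmodType S).

Definition coresolution_d n :
    {linear emb_mod (emb (cosyzygy n)) -> emb_mod (emb (cosyzygy n.+1))} :=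
  emb_in (emb (cosyzygy n.+1)) \o emb_pi (emb (cosyzygy n)).

Fact coresolution_dd n x : coresolution_d n.+1 (coresolution_d n x) = 0.
Proof. by rewrite /= [emb_pi _ _]emb_pi_in linear0. Qed.

Definition injective_coresolution : cochain S :=
  @Cochain S (fun n => emb_mod (emb (cosyzygy n))) coresolution_d coresolution_dd.

Lemma injective_coresolutionP :
  coresolution (@injective_module S) injective_coresolution (S^o : lmodType S).
Proof.
split.
- by move=> n; apply: emb_injective.
- exists (emb_in (emb (cosyzygy 0))); split; first exact: emb_in_inj.
  move=> x; split=> [/emb_in_eq0/emb_pi_ker//|/emb_pi_ker x0].
  by rewrite /is_cocycle /= x0 linear0.
- move=> [//|n] _ x /emb_in_eq0/emb_pi_ker[w <-].
  by have [y yw] := emb_pi_surj w; exists y; rewrite /= yw.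
Qed.

(** The middle term of W -> mod -> coker being injective, H^(n+1) with values in the cokernel embeds
    in H^(n+2) with values in W; each cosyzygy lowers the bound by one. *)
Lemma coh_zero_cosyzygy (F : matrix_resolution S) K :
  (forall n, (K <= n)%N -> coh_zero F n (S^o : lmodType S)) ->
  forall j n, (K <= n + j)%N -> coh_zero F n (cosyzygy j).
Proof.
move=> cohS; elim=> [|j IHj] n Kn; first by apply: cohS; rewrite addn0 in Kn.
have cohW : coh_zero F n.+1 (cosyzygy j) by apply: IHj; rewrite addSnnS.
rewrite /=; set x := emb (cosyzygy j) => phi phi0.
have [phi' phi'E] := @projective_row S _ _ _ (emb_pi x) phi (@emb_pi_surj _).
have [|theta thetaE] := @projective_lift S _ _ _ (emb_in x)
    (phi' \o mulmxr (dmx F n.+1)) (@projective_row S _).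
  by move=> y; apply/emb_pi_ker; rewrite phi'E phi0.
have [|psi psiE] := cohW theta.
  by move=> y; apply: emb_in_inj; rewrite thetaE /= -mulmxA mx_mx mulmx0 !linear0.
have [|chi chiE] := @coh_zero_injective S F n _ (@emb_injective _) (phi' \- (emb_in x \o psi)).
  by move=> y /=; rewrite -psiE thetaE subrr.
exists (emb_pi x \o chi) => y /=; rewrite -chiE /= linearB phi'E.
by rewrite (_ : emb_pi x _ = 0) ?subr0 //; apply: emb_pi_in.
Qed.

Lemma injective_cosyzygy_dim K : injective_module (cosyzygy K) ->
  (inj_dim (@injective_module S) (S^o : lmodType S) < +oo)%E.
Proof.
move=> injK; have cosyz0 n : (K < n)%N -> forall q : cosyzygy n, q = 0.
  elim: n => // n IHn; rewrite ltnS leq_eqVlt => /orP[/eqP <-|/IHn q0].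
    exact: emb_coker_trivial.
  exact/emb_coker_trivial/injective_trivial.
apply: (@le_lt_trans _ _ (cx_length injective_coresolution)).
  apply: ereal_inf_lbound; exists injective_coresolution => //.
  exact: injective_coresolutionP.
apply: (@le_lt_trans _ _ (K%:R%:E)); last exact: ltry.
apply: ge_ereal_sup => _ [n [x x0] <-]; rewrite lee_fin ler_nat leqNgt.
by apply: contra x0 => /cosyz0 W0; apply/eqP/emb_mod_trivial.
Qed.

End InjectiveCoresolution.

(** * Complexes behind the extended-real dimensions *)

Section LengthBounds.
Variable R : comPzRingType.

Lemma cx_length_bound (X : nat -> lmodType R) : (cx_length X < +oo)%E ->
  exists N, forall n, (N < n)%N -> forall x : X n, x = 0.
Proof.
move=> lX; pose r := fine (cx_length X).
(* If the length is -oo, [r] takes the default 0; this is harmless, as a nonzero [x] makes the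
   length finite. *)
exists (Num.bound `|r|) => n nN x; apply: contrapT => /eqP x0.
have nle : (n%:R%:E <= cx_length X)%E.
  by apply: ereal_sup_ubound; exists n => //; exists x.
have fX : cx_length X \is a fin_num.
  by rewrite fin_numElt lX andbT; apply: lt_le_trans nle; apply: ltNyr.
move: nle; rewrite -(fineK fX) lee_fin => nr.
have := archi_boundP (normr_ge0 r); apply/negP; rewrite -leNgt.
apply: le_trans (le_trans nr (ler_norm r)).
by rewrite ler_nat ltnW.
Qed.

(** Some coresolution has length below 1, so its first differential vanishes and [M] is its term of
    degree 0. *)
Lemma coresolution_length0 (XX : lmodType R -> Prop) (M : lmodType R) :
  inj_dim XX M = 0%E ->
  exists N : lmodType R, XX N /\ exists i : {linear M -> N}, bijective i.
Proof.
move=> idM; have [|_ [X [XXX [i [injI iE]] _] ->] X1] := @ereal_inf_lt _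
  [set e | exists2 X : cochain R, coresolution XX X M & e = cx_length X] 1%E.
  by move: idM; rewrite /inj_dim => ->; rewrite lte_fin.
exists (X 0%N); split; first exact: XXX.
exists i; have iS x : exists m, i m = x.
  apply/iE; rewrite /is_cocycle; apply: contrapT => /eqP dx.
  move: X1; rewrite ltNge => /negP; apply.
  by apply: ereal_sup_ubound; exists 1%N => //; exists (co_d X 0 x).
have /choice[j jE] := iS.
by exists j => // x; apply: injI; rewrite jE.
Qed.

Lemma resolution_finite (XX : lmodType R -> Prop) (M : lmodType R) :
  (proj_dim XX M < +oo)%E ->
  exists2 X : chain R, resolution XX X M &
    exists N, forall n, (N < n)%N -> forall x : X n, x = 0.
Proof.
by move=> /ereal_inf_lt[_ [X resX ->] /cx_length_bound]; exists X.
Qed.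

Lemma depth_Ext (N : lmodType R) : depth N \is a fin_num ->
  exists n (k : lmodType R), residue_field k /\ ~ Ext_zero n k N.
Proof.
move=> dN; apply: contrapT => nk; move: dN; rewrite /depth.
suff -> : [set n%:R%:E | n in [set n | exists2 k : lmodType R, residue_field k &
    ~ Ext_zero n k N]] = set0 :> set (\bar Rdefinitions.R) by rewrite ereal_inf0.
apply/seteqP; split=> // x [n [k resk Ek] _].
by case: nk; exists n, k.
Qed.

End LengthBounds.

Section LocalizedBaer.
Variables (R : comPzRingType) (p : set R) (S : comPzRingType)
  (f : {rmorphism R -> S}).
Hypotheses (primep : prime_ideal p) (locR : is_localization p f)
  (noethR : noetherian R).

(** Every ideal of [S] is generated by its contraction J, and the column of generators of J presents
    R/J. Index 0 of [coh_zero] is Ext^1, which is what extending a map from the ideal to [S]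
    requires. *)
Lemma localized_baer (W : lmodType S) :
  (forall F : matrix_resolution R, coh_zero (loc_resolution primep locR F) 0 W) ->
  injective_module W.
Proof.
move=> cohW; apply: baer_injective => G sG fG.
have [G0 GD GZ] := sG.
pose J : set S := [set z | exists y, G (z, y)].
have [|m [g [Jg gJ]]] := @contract_gen R S f noethR J.
  split=> [|x y [x' Gx] [y' Gy]|a x [x' Gx]]; first by exists 0.
    by exists (x' + y'); apply: (GD _ _ Gx Gy).
  by exists (a *: x'); apply: (GZ a _ Gx).
have /choice[w wP] := Jg.
pose A : 'M[R]_(m, 1) := \matrix_(i, j) g i.
have Glin (x : 'rV[S]_m) : G ((x *m map_mx f A) 0 0, lincomb w x).
  rewrite mxE /lincomb.
  have -> : (\sum_i x 0 i * map_mx f A i 0, \sum_i x 0 i *: w i) =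
      \sum_i x 0 i *: ((f (g i), w i) : (S^o * W)%type).
    rewrite [RHS]surjective_pairing (raddf_sum fst) (raddf_sum snd) /=.
    by congr pair; apply: eq_bigr => i _; rewrite !mxE.
  by apply: submodule_sum => // i; apply: (GZ _ _ (wP i)).
have [x|psi psiE] := cohW (free_resolution noethR A) (lincomb w).
  apply: fG; have := Glin (x *m map_mx f (dmx (free_resolution noethR A) 1)).
  rewrite -mulmxA -map_mxM.
  by rewrite (mx_mx (free_resolution noethR A) 0) map_mx0 mulmx0 mxE.
exists (psi (delta_mx 0 0)) => a y Gay.
have [r [s [ps aE]]] := loc_frac locR a.
have Gr : G (f r, f s *: y) by rewrite -aE mulrC; apply: (GZ (f s) _ Gay).
have [|b bE] := gJ r; first by exists (f s *: y).
have rE : f r = (map_mx f (\row_i b i) *m map_mx f A) 0 0.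
  by rewrite -map_mxM !mxE bE; congr (f _); apply: eq_bigr => i _; rewrite !mxE.
have yE := Glin (map_mx f (\row_i b i)); rewrite -rE in yE.
apply: (loc_cancel locR ps).
rewrite (functional_relE sG fG Gr yE) [LHS]psiE scalerA mulrC aE -linearZ_LR.
congr (psi _); apply/rowP => i; rewrite (ord1 i) rE.
by rewrite [RHS]mxE [delta_mx _ _ _ _]mxE mulr1.
Qed.

End LocalizedBaer.

Theorem theorem2p14 (R : comPzRingType) (noethR : noetherian R)
    (C M : lmodType R) (sdC : semidualizing C)
    (pdM : (proj_dim (P_ C) M < +oo)%E) (idM : inj_dim (I_ C) M = 0%E)
    (p : set R) (primep : prime_ideal p)
    (Rp : comPzRingType) (f : {rmorphism R -> Rp})
    (locR : is_localization p f)
    (Mp : lmodType Rp) (g : {linear M -> Mp | f \; *:%R})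
    (locM : is_localized_module p g)
    (depthM : depth Mp \is a fin_num) :
  gorenstein_local Rp.
Proof.
split; [exact: (loc_noetherian locR noethR)|exact: (loc_local primep locR)|].
have fgC : finitely_generated C by case: sdC.
have faithfulC r := @semidualizing_faithful R C r sdC.
have [M0 [[I injI [phi bij_phi]] [i bij_i]]] := coresolution_length0 idM.
have [mu bij_mu] : exists mu : {linear M -> lin_hom C I}, bijective mu.
  by exists (phi \o i); apply: bij_comp.
have [n [k [resk Ek]]] := depth_Ext depthM.
have [e eP] : exists e : I, forall r, r *: e = 0 <-> p r.
  apply: contrapT => /forallNP ne; apply: Ek.
  exact: (Ext_zero_localized primep locR noethR injI fgC bij_mu locM ne resk).
have [X [XC [eps [epsS epsK]] exX] [N X0]] := resolution_finite pdM.
have CX j : locally_retract C (X j) by apply: tensor_locally_retract.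
have [m [v vC]] := fgC.
have [F [aug [augR augK]]] := fg_resolution noethR v.
have augS x : exists y, aug y = x.
  have [y yE] := row_coefficients vC x.
  have : range aug x by rewrite augR; exists y.
  by case=> y' _; exists y'.
have cohX n' j : coh_zero F n' (X j).
  by apply: coh_zero_retract (CX j) _; apply: semidualizing_coh_zero sdC augS augK.
have lift psi := lift_to_chain cohX exX X0 augS augK epsS epsK psi.
have [mu' muK mu'K] := bij_mu.
(* An [I]-valued bilinear form on [C] is, through [mu], a map from [C] to [M]. *)
have [c [t [pt ct]]] : exists c t, ~ p t /\ forall x : C, exists r, t *: x = r *: c.
  apply: (loc_cyclic primep fgC faithfulC eP) => b c bc x.
  have [h hE] : exists h : {linear C -> M}, forall x, h x = mu' (b x).
    apply: (@linear_map_exists R R C M *:%R (mu' \o b)) => a y z /=.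
    by apply: (can_inj muK); rewrite mu'K [RHS]linearP /= !mu'K linearP.
  rewrite -[b x]mu'K -hE; apply: (evaluation_swap mu sdC CX epsK lift).
  by rewrite hE bc; apply: (can_inj muK); rewrite mu'K linear0.
have [E [pi [piS piK injE]]] := localized_injective primep locR noethR injI.
have piZ a x : pi (a *: x) = f a *: pi x by rewrite linearZ.
(* The annihilator of a nonzero [a] lies in the maximal ideal, which kills [pi e]; so [a] may be
   sent to [pi e]. *)
have cogE (A : lmodType Rp) (a : A) : a != 0 -> exists h : {linear A -> E}, h a != 0.
  move=> a0; have [||h hE] := @injective_extend Rp A E
    [set z | exists r, z = (r *: a, r *: pi e)] injE.
  - split=> [|_ _ [r ->] [r' ->]|b _ [r ->]].
    + by exists 0; rewrite !scale0r.
    + by exists (r + r'); rewrite !scalerDl.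
    + by exists (b * r); rewrite -!scalerA.
  - move=> _ [z [/esym za ->]]; have [r [s [ps zE]]] := loc_frac locR z.
    apply: (loc_cancel locR ps); rewrite scaler0 scalerA mulrC zE -piZ.
    suff /eP -> : p r by rewrite linear0.
    apply: contrapT => pr; move/eqP: a0; apply; apply: (loc_cancel locR pr).
    by rewrite scaler0 -zE mulrC -scalerA za scaler0.
  exists h; apply/eqP => ha; have : pi e = 0.
    by rewrite -ha; apply/esym/hE; exists 1; rewrite !scale1r.
  by move=> /piK[s ps /eP].
(* [tor_zero] holds for [M] from index [N.+1] on, so cohomology vanishes from there, and [N.+1]
   cosyzygies bring the bound down to the index 0 of Baer's criterion. *)
apply: (@injective_cosyzygy_dim Rp E injE cogE N.+1).
apply: (@localized_baer _ _ _ _ primep locR noethR) => F'.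
apply: (@coh_zero_cosyzygy _ _ injE cogE _ N.+1) => // n' Nn'.
apply: coh_zero_localized; apply: (local_coboundary injI eP).
apply: (tor_zero_hom primep injI bij_mu faithfulC pt ct).
case: n' Nn' => // n' Nn'.
apply: (tor_zero_resolved primep _ exX X0 epsS epsK) => // n'' j.
apply: (tor_zero_retract primep (CX j)).
exact: (tor_zero_cyclic primep faithfulC pt ct).
Qed.
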